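(* Let $\widetilde\Gamma(x)=\frac1x e^{x\log 2}\prod_{k=1}^\infty\left(e^{-x/k}(1+x/k)\right)^{(-1)^{k+1}}$, let $\zeta_E(z,x)$ be the alternating Hurwitz zeta function, $\zeta_E(z)=\zeta_E(z,1)$, and let $'$ denote differentiation with respect to $z$. For $\mathrm{Re}(x)>0$, $$\log\widetilde\Gamma(x)=\zeta_E'(0,x)+\zeta_E'(0).$$
   Context: In the product defining $\widetilde\Gamma$, for odd $k$ the factor is $e^{-x/k}(1+x/k)$ and for even $k$ it is its reciprocal. For $\mathrm{Re}(z)>0$, $\zeta_E(z,x)=\sum_{n=0}^\infty\frac{(-1)^n}{(n+x)^z}$; it extends analytically in $z$ to all of $\mathbb{C}$, and $\zeta_E'(0,x)$ refers to this continuation. $\log\widetilde\Gamma$ denotes the branch holomorphic on $\mathrm{Re}(x)>0$ that is real on $(0,\infty)$. *)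

(* Defs.v *)
From Stdlib Require Import Reals ClassicalEpsilon.
From Coquelicot Require Import Coquelicot.
Open Scope R_scope.

(** * Exponential, principal logarithm and principal powers on [C] *)

Definition Cexp (w : C) : C := (exp (Re w) * cos (Im w), exp (Re w) * sin (Im w)).

(** Principal argument with values in [(-PI, PI]]; [Carg 0] is irrelevant. *)
Definition Carg (w : C) : R :=
  if Rlt_dec 0 (Re w) then atan (Im w / Re w)
  else if Rlt_dec 0 (Im w) then PI / 2 - atan (Re w / Im w)
  else if Rlt_dec (Im w) 0 then - (PI / 2) - atan (Re w / Im w)
  else PI.

Definition Clog (w : C) : C := (ln (Cmod w), Carg w).

Definition Cpower (w z : C) : C := Cexp (z * Clog w).

(** [C_NormedModule] is named explicitly because inference could otherwise
    select the real-linear structure on [C]. *)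
Definition holomorphic_at (f : C -> C) (z : C) : Prop :=
  @ex_derive C_AbsRing C_NormedModule f z.

(** * The function [Gamma~] *)

Fixpoint Cprod1 (a : nat -> C) (N : nat) : C :=
  match N with
  | O => 1
  | S n => Cprod1 a n * a (S n)
  end.

Definition Clim_seq (u : nat -> C) : C :=
  (real (Lim_seq (fun n => Re (u n))), real (Lim_seq (fun n => Im (u n)))).

(** The exponent [(-1)^(k+1)] is [1] for odd [k] and [-1] for even [k]. *)
Definition tGamma_factor (x : C) (k : nat) : C :=
  let w := (Cexp (- (x / INR k)) * (1 + x / INR k))%C in
  if Nat.odd k then w else / w.

Definition tGamma (x : C) : C :=
  / x * Cexp (x * ln 2) * Clim_seq (Cprod1 (tGamma_factor x)).

Definition is_log_tGamma (L : C -> C) : Prop :=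
  (forall x : C, 0 < Re x -> holomorphic_at L x) /\
  (forall x : C, 0 < Re x -> Cexp (L x) = tGamma x) /\
  (forall r : R, 0 < r -> Im (L r) = 0).

(** Only the values on the right half-plane are determined. *)
Definition log_tGamma : C -> C :=
  epsilon (inhabits (fun _ : C => RtoC 0)) is_log_tGamma.

(** * The alternating Hurwitz zeta function *)

Definition zetaE_term (z x : C) (n : nat) : C :=
  RtoC ((-1) ^ n) / Cpower (INR n + x) z.

(** The series converges only conditionally for [0 < Re z <= 1]; [is_series]
    is convergence of the partial sums. *)
Definition is_zetaE (x : C) (f : C -> C) : Prop :=
  (forall z : C, holomorphic_at f z) /\
  (forall z : C, 0 < Re z ->
     @is_series C_AbsRing C_NormedModule (zetaE_term z x) (f z)).

(** By the identity theorem at most one entire function satisfies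
    [is_zetaE x]; it is the analytic continuation of the series. *)
Definition zetaE (z x : C) : C :=
  epsilon (inhabits (fun _ : C => RtoC 0)) (is_zetaE x) z.

Definition zetaE' (z x : C) : C := C_derive (fun w => zetaE w x) z.

Definition zetaE1 (z : C) : C := zetaE z 1.

Definition zetaE1' (z : C) : C := C_derive zetaE1 z.

(* Main.v *)
(** The continuation rests on Euler's averaging: for a smooth [g],
    [2 sum (-1)^n g(x+n) = g(x) - int_0^1 sum (-1)^n g'(x+u+n) du]. With
    [g(x) = x^(-z)] this reads
    [zetaE z x = x^(-z) / 2 + (z / 2) int_0^1 zetaE (z+1) (x+u) du],
    which extends the absolutely convergent range of [z] one unit to the left at
    each application. An entire function agreeing with the series for
    [0 < Re z] is determined at [0] to first order by its values on [(0, +oo)],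
    so the formula also gives
    [2 zetaE' 0 x = - log x + int_0^1 zetaE 1 (x+u) du]. Integrating the partial
    sums of [zetaE 1] makes [zetaE' 0 x + zetaE' 0 1] the limit of
    [- log x + sum_(1 <= k <= N) (-1)^(k+1) (log (x+k) - log k)], which is
    holomorphic in [x], real on [(0, +oo)], and has exponential [tGamma x]
    because [sum (-1)^(k+1) / k = ln 2]. Such a logarithm is unique by the
    intermediate value theorem along vertical lines. *)

Require Import Defs.
From Stdlib Require Import Reals Lra Lia Psatz ClassicalEpsilon.
From Coquelicot Require Import Coquelicot.
Open Scope R_scope.

Lemma C_ext (a b : C) : Re a = Re b -> Im a = Im b -> a = b.
Proof. destruct a, b; simpl; congruence. Qed.

Lemma Cmod_le_abs (w : C) : Cmod w <= Rabs (Re w) + Rabs (Im w).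
Proof.
  replace w with (RtoC (Re w) + RtoC (Im w) * Ci)%C at 1
    by (apply C_ext; simpl; ring).
  eapply Rle_trans; [apply Cmod_triangle|].
  rewrite Cmod_mult, Cmod_Ci, !Cmod_R; lra.
Qed.

Lemma im_le_Cmod (w : C) : Rabs (Im w) <= Cmod w.
Proof.
  eapply Rle_trans; [|apply Rmax_Cmod]; apply Rmax_r.
Qed.

Lemma Cmod_pos_Re (w : C) : 0 < Re w -> 0 < Cmod w.
Proof.
  intros H; generalize (re_le_Cmod w) (Rle_abs (Re w)); lra.
Qed.

Lemma C_neq0_Re (w : C) : 0 < Re w -> w <> RtoC 0.
Proof. intros H E; rewrite E in H; simpl in H; lra. Qed.

Lemma Cmod_sq (w : C) : Cmod w * Cmod w = Re w * Re w + Im w * Im w.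
Proof.
  generalize (Cmod2_alt w); simpl; intros H; nra.
Qed.

Lemma Cmod_minus_sym (a b : C) : Cmod (a - b) = Cmod (b - a).
Proof. rewrite <- Cmod_opp; f_equal; ring. Qed.

Lemma Cmod_tri_minus (a b c : C) : Cmod (a - c) <= Cmod (a - b) + Cmod (b - c).
Proof. replace (a - c)%C with ((a - b) + (b - c))%C by ring; apply Cmod_triangle. Qed.

Lemma Cmod_minus_le (a b : C) : Cmod (a - b) <= Cmod a + Cmod b.
Proof. unfold Cminus; eapply Rle_trans; [apply Cmod_triangle|]; rewrite Cmod_opp; lra. Qed.

Lemma Cexp_plus (a b : C) : Cexp (a + b) = (Cexp a * Cexp b)%C.
Proof.
  apply C_ext; unfold Re, Im; simpl; unfold Re, Im; rewrite exp_plus, ?cos_plus, ?sin_plus; ring.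
Qed.

Lemma Cexp_0 : Cexp 0 = 1.
Proof. apply C_ext; simpl; rewrite exp_0, ?cos_0, ?sin_0; ring. Qed.

Lemma Cexp_neq0 (a : C) : Cexp a <> RtoC 0.
Proof.
  intros E; assert (H : (Cexp a * Cexp (- a))%C = RtoC 1).
  { rewrite <- Cexp_plus, Cplus_opp_r; apply Cexp_0. }
  rewrite E, Cmult_0_l in H; injection H; lra.
Qed.

Lemma Cexp_opp (a : C) : Cexp (- a) = (/ Cexp a)%C.
Proof.
  assert (H : (Cexp a * Cexp (- a))%C = RtoC 1).
  { rewrite <- Cexp_plus, Cplus_opp_r; apply Cexp_0. }
  replace (Cexp (-a)) with (Cexp a * Cexp (- a) / Cexp a)%C
    by (field; apply Cexp_neq0).
  rewrite H; field; apply Cexp_neq0.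
Qed.

Lemma Cmod_Cexp (a : C) : Cmod (Cexp a) = exp (Re a).
Proof.
  apply Rsqr_inj; [apply Cmod_ge_0|left; apply exp_pos|].
  unfold Rsqr; rewrite Cmod_sq; simpl.
  generalize (sin2_cos2 (snd a)); unfold Rsqr, Im, Re; intros H.
  transitivity (exp (fst a) * exp (fst a) * (sin (snd a) * sin (snd a) + cos (snd a) * cos (snd a))); [ring|].
  rewrite H; ring.
Qed.

Lemma Cexp_Clog (w : C) : 0 < Re w -> Cexp (Clog w) = w.
Proof.
  intros H; unfold Cexp, Clog, Carg; simpl.
  destruct (Rlt_dec 0 (Re w)) as [_|]; [|tauto].
  rewrite exp_ln by now apply Cmod_pos_Re.
  rewrite cos_atan, sin_atan.
  assert (E : Cmod w = Re w * sqrt (1 + (Im w / Re w)²)).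
  { unfold Cmod; change (fst w) with (Re w); change (snd w) with (Im w).
    rewrite <- (sqrt_Rsqr (Re w)) at 2 by lra.
    rewrite <- sqrt_mult; [|apply Rle_0_sqr|generalize (Rle_0_sqr (Im w / Re w)); lra].
    f_equal; unfold Rsqr; field; lra. }
  assert (P : 0 < sqrt (1 + (Im w / Re w)²)).
  { apply sqrt_lt_R0; generalize (Rle_0_sqr (Im w / Re w)); lra. }
  rewrite E; apply C_ext; simpl; field; lra.
Qed.

(** * Complex-valued functions of a real variable *)

Definition Cder (f : R -> C) (t : R) (d : C) : Prop :=
  is_derive (fun s => Re (f s)) t (Re d) /\ is_derive (fun s => Im (f s)) t (Im d).

Definition Ccont (f : R -> C) (t : R) : Prop :=
  continuous (fun s => Re (f s)) t /\ continuous (fun s => Im (f s)) t.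

Definition Cint (f : R -> C) (a b : R) : C :=
  (RInt (fun s => Re (f s)) a b, RInt (fun s => Im (f s)) a b).

Lemma is_derive_cont (f : R -> R) (t d : R) : is_derive f t d -> continuous f t.
Proof. intros H; apply @ex_derive_continuous; exists d; exact H. Qed.

Lemma Cder_cont f t d : Cder f t d -> Ccont f t.
Proof.
  intros [H1 H2]; split; eapply is_derive_cont; eassumption.
Qed.

Lemma Cder_const (c : C) t : Cder (fun _ => c) t 0.
Proof. split; exact (is_derive_const _ t). Qed.

Lemma Cder_affine (p q : C) t : Cder (fun s => (p + RtoC s * q)%C) t q.
Proof. split; simpl; auto_derive; auto; unfold Re, Im; ring. Qed.

Lemma Cder_shift (y t : R) : Cder (fun s => (s, y)) t 1.
Proof. split; simpl; auto_derive; auto. Qed.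

Lemma Cder_ext f g t d : (forall s, f s = g s) -> Cder f t d -> Cder g t d.
Proof.
  intros E [H1 H2]; split; (eapply is_derive_ext; [|eassumption]); intros s; simpl; now rewrite E.
Qed.

Lemma is_derive_Rmult (f g : R -> R) (t d e : R) : is_derive f t d -> is_derive g t e ->
  is_derive (fun s => f s * g s) t (d * g t + f t * e).
Proof. intros H K; apply (is_derive_mult f g t d e H K); intros; apply Rmult_comm. Qed.

Lemma is_derive_Rplus (f g : R -> R) (t d e : R) : is_derive f t d -> is_derive g t e ->
  is_derive (fun s => f s + g s) t (d + e).
Proof. exact (is_derive_plus f g t d e). Qed.

Lemma is_derive_Rminus (f g : R -> R) (t d e : R) : is_derive f t d -> is_derive g t e ->
  is_derive (fun s => f s - g s) t (d - e).
Proof. exact (is_derive_minus f g t d e). Qed.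

Lemma is_derive_Rcomp (f g : R -> R) (t d e : R) : is_derive f (g t) d -> is_derive g t e ->
  is_derive (fun s => f (g s)) t (e * d).
Proof. exact (is_derive_comp f g t d e). Qed.

Lemma is_derive_eq (f : R -> R) (t d e : R) : is_derive f t d -> d = e -> is_derive f t e.
Proof. now intros H <-. Qed.

Lemma Cder_plus f g t d e : Cder f t d -> Cder g t e -> Cder (fun s => (f s + g s)%C) t (d + e)%C.
Proof.
  intros [H1 H2] [H3 H4]; split; [apply (is_derive_Rplus _ _ _ _ _ H1 H3)
    |apply (is_derive_Rplus _ _ _ _ _ H2 H4)].
Qed.

Lemma Cder_minus f g t d e : Cder f t d -> Cder g t e -> Cder (fun s => (f s - g s)%C) t (d - e)%C.
Proof.
  intros [H1 H2] [H3 H4]; split; [apply (is_derive_Rminus _ _ _ _ _ H1 H3)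
    |apply (is_derive_Rminus _ _ _ _ _ H2 H4)].
Qed.

Lemma Cder_mult f g t d e : Cder f t d -> Cder g t e ->
  Cder (fun s => (f s * g s)%C) t (d * g t + f t * e)%C.
Proof.
  intros [H1 H2] [H3 H4]; split; eapply is_derive_eq.
  - exact (is_derive_Rminus _ _ _ _ _ (is_derive_Rmult _ _ _ _ _ H1 H3)
      (is_derive_Rmult _ _ _ _ _ H2 H4)).
  - unfold Re, Im; simpl; ring.
  - exact (is_derive_Rplus _ _ _ _ _ (is_derive_Rmult _ _ _ _ _ H1 H4)
      (is_derive_Rmult _ _ _ _ _ H2 H3)).
  - unfold Re, Im; simpl; ring.
Qed.

Lemma Cder_scal (c : C) f t d : Cder f t d -> Cder (fun s => (c * f s)%C) t (c * d)%C.
Proof.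
  intros H; replace (c * d)%C with (0 * f t + c * d)%C by ring.
  apply Cder_mult; [apply Cder_const|exact H].
Qed.

Lemma Cder_Cexp f t d : Cder f t d -> Cder (fun s => Cexp (f s)) t (d * Cexp (f t))%C.
Proof.
  intros [H1 H2]; split; eapply is_derive_eq.
  - exact (is_derive_Rmult _ _ _ _ _ (is_derive_Rcomp exp _ _ _ _ (is_derive_exp _) H1)
      (is_derive_Rcomp cos _ _ _ _ (is_derive_cos _) H2)).
  - unfold Re, Im; simpl; unfold Re, Im; ring.
  - exact (is_derive_Rmult _ _ _ _ _ (is_derive_Rcomp exp _ _ _ _ (is_derive_exp _) H1)
      (is_derive_Rcomp sin _ _ _ _ (is_derive_sin _) H2)).
  - unfold Re, Im; simpl; unfold Re, Im; ring.
Qed.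

Lemma is_derive_ln_hypot (a b : R -> R) (t da db : R) :
  is_derive a t da -> is_derive b t db -> 0 < a t ->
  is_derive (fun s => ln (sqrt (a s ^ 2 + b s ^ 2))) t
    ((a t * da + b t * db) / (a t ^ 2 + b t ^ 2)).
Proof.
  intros Ha Hb P.
  assert (N : 0 < a t ^ 2 + b t ^ 2) by nra.
  generalize (sqrt_lt_R0 _ N) (sqrt_sqrt _ (Rlt_le _ _ N)); intros Q1 Q2.
  auto_derive.
  - repeat split; try (eexists; eassumption); simpl in *; lra.
  - rewrite (is_derive_unique (fun s : R => a s) _ _ Ha : Derive (fun s : R => a s) t = da),
      (is_derive_unique (fun s : R => b s) _ _ Hb : Derive (fun s : R => b s) t = db).
    replace (a t * (a t * 1) + b t * (b t * 1)) with (a t ^ 2 + b t ^ 2) by ring.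
    set (q := sqrt _) in *; rewrite <- Q2; field; lra.
Qed.

Lemma is_derive_atan_div (a b : R -> R) (t da db : R) :
  is_derive a t da -> is_derive b t db -> 0 < a t ->
  is_derive (fun s => atan (b s / a s)) t
    ((a t * db - b t * da) / (a t ^ 2 + b t ^ 2)).
Proof.
  intros Ha Hb P.
  auto_derive.
  - repeat split; try (eexists; eassumption); lra.
  - rewrite (is_derive_unique (fun s : R => a s) _ _ Ha : Derive (fun s : R => a s) t = da),
      (is_derive_unique (fun s : R => b s) _ _ Hb : Derive (fun s : R => b s) t = db).
    unfold Rsqr; field; repeat split; nra.
Qed.

Lemma Cder_Clog f t d : Cder f t d -> 0 < Re (f t) -> Cder (fun s => Clog (f s)) t (d / f t)%C.
Proof.
  intros [H1 H2] Hp.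
  assert (L : locally t (fun s => 0 < Re (f s))).
  { assert (K : continuous (fun s => Re (f s)) t)
      by (eapply is_derive_cont; eassumption).
    apply K; apply (open_gt 0); exact Hp. }
  assert (N : Re (f t) ^ 2 + Im (f t) ^ 2 <> 0) by nra.
  split.
  - eapply is_derive_eq; [exact (is_derive_ln_hypot _ _ _ _ _ H1 H2 Hp)|].
    unfold Re, Im in *; simpl in *; field; nra.
  - eapply is_derive_ext_loc with (fun s => atan (Im (f s) / Re (f s))).
    + revert L; apply filter_imp; intros s Hs; simpl; unfold Carg.
      destruct (Rlt_dec 0 (Re (f s))); tauto.
    + eapply is_derive_eq; [exact (is_derive_atan_div _ _ _ _ _ H1 H2 Hp)|].
      unfold Re, Im in *; simpl in *; field; nra.
Qed.

Lemma Cder_bound f df M : (forall t, 0 <= t <= 1 -> Cder f t (df t)) ->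
  (forall t, 0 <= t <= 1 -> Cmod (df t) <= M) -> Cmod (f 1 - f 0) <= 2 * M.
Proof.
  intros H B.
  assert (G : forall g dg, (forall t, 0 <= t <= 1 -> is_derive g t (dg t)) ->
    (forall t, 0 <= t <= 1 -> Rabs (dg t) <= M) -> Rabs (g 1 - g 0) <= M).
  { intros g dg G1 G2.
    destruct (MVT_gen g 0 1 dg) as [c [Hc E]].
    - rewrite Rmin_left, Rmax_right by lra; intros; apply G1; lra.
    - rewrite Rmin_left, Rmax_right by lra; intros x Hx.
      eapply continuity_pt_filterlim, is_derive_cont, G1, Hx.
    - rewrite Rmin_left, Rmax_right in Hc by lra.
      rewrite E, Rminus_0_r, Rmult_1_r; now apply G2. }
  eapply Rle_trans; [apply Cmod_le_abs|].
  assert (Rabs (Re (f 1) - Re (f 0)) <= M).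
  { apply (G (fun t => Re (f t)) (fun t => Re (df t))).
    - intros; now apply H.
    - intros t Ht; eapply Rle_trans; [apply re_le_Cmod|auto]. }
  assert (Rabs (Im (f 1) - Im (f 0)) <= M).
  { apply (G (fun t => Im (f t)) (fun t => Im (df t))).
    - intros; now apply H.
    - intros t Ht; eapply Rle_trans; [apply im_le_Cmod|auto]. }
  simpl; unfold Re, Im, Rminus in *; lra.
Qed.

Lemma exp_le (a b : R) : a <= b -> exp a <= exp b.
Proof. intros [H|H]; [left; now apply exp_increasing|rewrite H; lra]. Qed.

Lemma Cexp_bound1 (v : C) : Cmod (Cexp v - 1) <= 2 * (Cmod v * exp (Cmod v)).
Proof.
  replace (Cexp v - 1)%C with (Cexp (0 + RtoC 1 * v) - Cexp (0 + RtoC 0 * v))%C.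
  2:{ replace (0 + RtoC 0 * v)%C with (RtoC 0) by ring.
      replace (0 + RtoC 1 * v)%C with v by ring. now rewrite Cexp_0. }
  apply (Cder_bound (fun t => Cexp (0 + RtoC t * v)) (fun t => (v * Cexp (0 + RtoC t * v))%C)).
  - intros t _; apply Cder_Cexp, Cder_affine.
  - intros t Ht; rewrite Cmod_mult, Cmod_Cexp.
    apply Rmult_le_compat_l; [apply Cmod_ge_0|].
    apply exp_le; eapply Rle_trans; [apply Rle_abs|].
    eapply Rle_trans; [apply re_le_Cmod|].
    replace (0 + RtoC t * v)%C with (RtoC t * v)%C by ring.
    rewrite Cmod_mult, Cmod_R, Rabs_pos_eq by lra.
    generalize (Cmod_ge_0 v); nra.
Qed.

Lemma Cexp_bound2 (v : C) :
  Cmod (Cexp v - 1 - v) <= 4 * (Cmod v * Cmod v * exp (Cmod v)).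
Proof.
  replace (Cexp v - 1 - v)%C with ((Cexp (0 + RtoC 1 * v) - (0 + RtoC 1 * v)) - (Cexp (0 + RtoC 0 * v) - (0 + RtoC 0 * v)))%C.
  2:{ replace (0 + RtoC 0 * v)%C with (RtoC 0) by ring.
      replace (0 + RtoC 1 * v)%C with v by ring. rewrite Cexp_0; ring. }
  replace (4 * _) with (2 * (Cmod v * (2 * (Cmod v * exp (Cmod v))))) by ring.
  apply (Cder_bound (fun t => (Cexp (0 + RtoC t * v) - (0 + RtoC t * v))%C)
    (fun t => (v * Cexp (0 + RtoC t * v) - v)%C)).
  - intros t _; apply Cder_minus; [apply Cder_Cexp|]; apply Cder_affine.
  - intros t Ht.
    replace (v * Cexp (0 + RtoC t * v) - v)%C with (v * (Cexp (RtoC t * v) - 1))%C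
      by (rewrite Cplus_0_l; ring).
    rewrite Cmod_mult.
    apply Rmult_le_compat_l; [apply Cmod_ge_0|].
    eapply Rle_trans; [apply Cexp_bound1|].
    assert (Cmod (RtoC t * v) <= Cmod v).
    { rewrite Cmod_mult, Cmod_R, Rabs_pos_eq by lra. generalize (Cmod_ge_0 v); nra. }
    apply Rmult_le_compat_l; [lra|].
    apply Rmult_le_compat; auto using Cmod_ge_0; [left; apply exp_pos|now apply exp_le].
Qed.

Lemma Clog_bound (w h : C) : 0 < Re w -> Cmod h <= Re w / 2 ->
  Cmod (Clog (w + h) - Clog w - h / w) <= 4 * (Cmod h * Cmod h / (Cmod w * Cmod w)).
Proof.
  intros Hw Hh.
  assert (Pw := Cmod_pos_Re _ Hw).
  assert (Lw : Re w <= Cmod w) by (generalize (re_le_Cmod w) (Rle_abs (Re w)); lra).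
  assert (Ph := Cmod_ge_0 h).
  assert (Nw := C_neq0_Re _ Hw).
  assert (Q : forall t, 0 <= t <= 1 -> 0 < Re (w + RtoC t * h) /\ Cmod w / 2 <= Cmod (w + RtoC t * h)).
  { intros t Ht.
    assert (B : Cmod (RtoC t * h) <= Re w / 2).
    { rewrite Cmod_mult, Cmod_R, Rabs_pos_eq by lra; nra. }
    split.
    - generalize (re_le_Cmod (RtoC t * h)) (Rle_abs (- Re (RtoC t * h))); rewrite Rabs_Ropp.
      change (Re (w + RtoC t * h)) with (Re w + Re (RtoC t * h)); lra.
    - assert (K : Cmod w <= Cmod (w + RtoC t * h) + Cmod (RtoC t * h)).
      { replace w with ((w + RtoC t * h) - RtoC t * h)%C at 1 by ring; apply Cmod_minus_le. }
      lra. }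
  replace (Clog (w + h) - Clog w - h / w)%C with
   ((Clog (w + RtoC 1 * h) - (0 + RtoC 1 * (h / w))) - (Clog (w + RtoC 0 * h) - (0 + RtoC 0 * (h / w))))%C.
  2:{ replace (w + RtoC 0 * h)%C with w by ring. replace (w + RtoC 1 * h)%C with (w + h)%C by ring. ring. }
  replace (4 * _) with (2 * (2 * (Cmod h * Cmod h / (Cmod w * Cmod w)))) by ring.
  apply (Cder_bound (fun t => (Clog (w + RtoC t * h) - (0 + RtoC t * (h / w)))%C)
    (fun t => (h / (w + RtoC t * h) - h / w)%C)).
  - intros t Ht; apply Cder_minus; [apply Cder_Clog; [|now apply Q]|]; apply Cder_affine.
  - intros t Ht; destruct (Q t Ht) as [Q1 Q2].
    assert (Nt := C_neq0_Re _ Q1).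
    replace (h / (w + RtoC t * h) - h / w)%C with (- (RtoC t * (h * h) / (w * (w + RtoC t * h))))%C
      by (field; auto).
    rewrite Cmod_opp, Cmod_div by (apply Cmult_neq_0; auto).
    rewrite !Cmod_mult, Cmod_R, Rabs_pos_eq by lra.
    apply Rle_trans with (Cmod h * Cmod h / (Cmod w * (Cmod w / 2))); [|right; field; lra].
    unfold Rdiv at 1 2; apply Rmult_le_compat.
    + repeat apply Rmult_le_pos; lra.
    + left; apply Rinv_0_lt_compat, Rmult_lt_0_compat; lra.
    + assert (0 <= Cmod h * Cmod h) by nra; nra.
    + apply Rinv_le_contravar; [nra|]. apply Rmult_le_compat_l; lra.
Qed.

(** * Limits of complex sequences *)

Definition Climit (u : nat -> C) (l : C) : Prop :=
  forall eps, 0 < eps -> exists N, forall n, (N <= n)%nat -> Cmod (u n - l) < eps.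

Lemma Climit_Re u l : Climit u l -> is_lim_seq (fun n => Re (u n)) (Re l).
Proof.
  intros H; apply is_lim_seq_spec; intros eps.
  destruct (H eps (cond_pos eps)) as [N HN]; exists N; intros n Hn.
  eapply Rle_lt_trans; [|apply (HN n Hn)].
  apply (re_le_Cmod (u n - l)).
Qed.

Lemma Climit_Im u l : Climit u l -> is_lim_seq (fun n => Im (u n)) (Im l).
Proof.
  intros H; apply is_lim_seq_spec; intros eps.
  destruct (H eps (cond_pos eps)) as [N HN]; exists N; intros n Hn.
  eapply Rle_lt_trans; [|apply (HN n Hn)].
  apply (im_le_Cmod (u n - l)).
Qed.

Lemma Climit_Clim_seq u l : Climit u l -> Clim_seq u = l.
Proof.
  intros H; unfold Clim_seq.
  rewrite (is_lim_seq_unique _ _ (Climit_Re _ _ H)), (is_lim_seq_unique _ _ (Climit_Im _ _ H)).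
  now destruct l.
Qed.

Lemma Climit_unique u l l' : Climit u l -> Climit u l' -> l = l'.
Proof. intros H K; now rewrite <- (Climit_Clim_seq _ _ H), <- (Climit_Clim_seq _ _ K). Qed.

Lemma Climit_ext u v l : (forall n, u n = v n) -> Climit u l -> Climit v l.
Proof. intros E H eps He; destruct (H eps He) as [N HN]; exists N; intros; rewrite <- E; auto. Qed.

Lemma Climit_const c : Climit (fun _ => c) c.
Proof.
  intros eps He; exists 0%nat; intros; replace (c - c)%C with (RtoC 0) by ring.
  now rewrite Cmod_0.
Qed.

Lemma Climit_plus u v l m : Climit u l -> Climit v m -> Climit (fun n => (u n + v n)%C) (l + m)%C.
Proof.
  intros H K eps He; destruct (H (eps / 2)) as [N HN]; [lra|].
  destruct (K (eps / 2)) as [N' HN']; [lra|].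
  exists (Nat.max N N'); intros n Hn.
  replace (u n + v n - (l + m))%C with ((u n - l) + (v n - m))%C by ring.
  eapply Rle_lt_trans; [apply Cmod_triangle|].
  generalize (HN n ltac:(lia)) (HN' n ltac:(lia)); lra.
Qed.

Lemma Climit_scal c u l : Climit u l -> Climit (fun n => (c * u n)%C) (c * l)%C.
Proof.
  intros H eps He; assert (P := Cmod_ge_0 c).
  destruct (H (eps / (Cmod c + 1))) as [N HN]; [apply Rdiv_lt_0_compat; lra|].
  exists N; intros n Hn; replace (c * u n - c * l)%C with (c * (u n - l))%C by ring.
  rewrite Cmod_mult; specialize (HN n Hn).
  apply Rle_lt_trans with ((Cmod c + 1) * Cmod (u n - l)).
  - generalize (Cmod_ge_0 (u n - l)); nra.
  - replace eps with ((Cmod c + 1) * (eps / (Cmod c + 1))) by (field; lra).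
    apply Rmult_lt_compat_l; lra.
Qed.

Lemma Climit_minus u v l m : Climit u l -> Climit v m -> Climit (fun n => (u n - v n)%C) (l - m)%C.
Proof.
  intros H K; replace (l - m)%C with (l + (-(1)) * m)%C by ring.
  eapply Climit_ext; [|apply Climit_plus; [exact H|apply Climit_scal, K]].
  intros; simpl; ring.
Qed.

Lemma Climit_succ u l : Climit u l -> Climit (fun n => u (S n)) l.
Proof. intros H eps He; destruct (H eps He) as [N HN]; exists N; intros; apply HN; lia. Qed.

Lemma Climit_bound u l M : Climit u l -> (forall n, Cmod (u n) <= M) -> Cmod l <= M.
Proof.
  intros H B; apply Rnot_lt_le; intros K.
  destruct (H (Cmod l - M)) as [N HN]; [lra|].
  specialize (HN N (le_n _)); rewrite Cmod_minus_sym in HN; specialize (B N).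
  assert (Cmod l <= Cmod (l - u N) + Cmod (u N)).
  { replace l with ((l - u N) + u N)%C at 1 by ring; apply Cmod_triangle. }
  lra.
Qed.

Lemma Climit_Cexp u l : Climit u l -> Climit (fun n => Cexp (u n)) (Cexp l).
Proof.
  intros H eps He.
  assert (P : 0 < Cmod (Cexp l)) by (rewrite Cmod_Cexp; apply exp_pos).
  set (q := Cmod (Cexp l)) in *.
  assert (E1 := exp_pos 1).
  assert (D : 0 < eps / (2 * q * exp 1)) by (apply Rdiv_lt_0_compat; [lra|nra]).
  destruct (H (Rmin 1 (eps / (2 * q * exp 1)))) as [N HN].
  { apply Rmin_pos; lra. }
  exists N; intros n Hn; specialize (HN n Hn).
  assert (HN1 := Rlt_le_trans _ _ _ HN (Rmin_l _ _)).
  assert (HN2 := Rlt_le_trans _ _ _ HN (Rmin_r _ _)).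
  replace (Cexp (u n) - Cexp l)%C with (Cexp l * (Cexp (u n - l) - 1))%C.
  2:{ transitivity (Cexp l * Cexp (u n - l) - Cexp l)%C; [ring|].
      rewrite <- Cexp_plus; f_equal; f_equal; ring. }
  rewrite Cmod_mult; fold q.
  apply Rle_lt_trans with (q * (2 * (Cmod (u n - l) * exp 1))).
  - apply Rmult_le_compat_l; [lra|].
    eapply Rle_trans; [apply Cexp_bound1|].
    apply Rmult_le_compat_l; [lra|]; apply Rmult_le_compat_l; [apply Cmod_ge_0|].
    apply exp_le; lra.
  - replace eps with (2 * q * exp 1 * (eps / (2 * q * exp 1))) by (field; lra).
    replace (q * (2 * (Cmod (u n - l) * exp 1))) with (2 * q * exp 1 * Cmod (u n - l)) by ring.
    apply Rmult_lt_compat_l; [nra|lra].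
Qed.

Lemma Climit_telescope u K : 
  (forall n, Cmod (u (S n) - u n) <= K / ((INR n + 1) * (INR n + 2))) ->
  Climit u (Clim_seq u) /\ forall n, Cmod (u n - Clim_seq u) <= K / (INR n + 1).
Proof.
  intros H.
  assert (K0 : 0 <= K).
  { specialize (H 0%nat); simpl in H; generalize (Cmod_ge_0 (u 1%nat - u 0%nat)); lra. }
  assert (T : forall n m, Cmod (u (n + m)%nat - u n) <= K / (INR n + 1) - K / (INR (n + m) + 1)).
  { intros n m; induction m as [|m IH].
    - rewrite Nat.add_0_r; replace (u n - u n)%C with (RtoC 0) by ring; rewrite Cmod_0; lra.
    - rewrite Nat.add_succ_r.
      eapply Rle_trans; [apply (Cmod_tri_minus _ (u (n + m)%nat))|].
      specialize (H (n + m)%nat); rewrite S_INR.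
      assert (Q := pos_INR (n + m)).
      replace (K / ((INR (n + m) + 1) * (INR (n + m) + 2))) with
        (K / (INR (n + m) + 1) - K / (INR (n + m) + 1 + 1)) in H by (field; lra).
      lra. }
  assert (T' : forall n m, (n <= m)%nat -> Cmod (u m - u n) <= K / (INR n + 1)).
  { intros n m Hm; replace m with (n + (m - n))%nat by lia.
    eapply Rle_trans; [apply T|].
    generalize (pos_INR (n + (m - n))); intros Q.
    assert (0 <= K / (INR (n + (m - n)) + 1)) by (apply Rdiv_le_0_compat; lra); lra. }
  assert (Z : forall eps, 0 < eps -> exists N, forall n, (N <= n)%nat -> K / (INR n + 1) < eps).
  { intros eps He; destruct (archimed_cor1 (eps / (K + 1))) as [N [HN1 HN2]].
    { apply Rdiv_lt_0_compat; lra. }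
    exists N; intros n Hn.
    assert (P : 0 < INR N) by (apply lt_0_INR; lia).
    assert (Q : INR N <= INR n) by (apply le_INR; lia).
    apply Rle_lt_trans with (K / INR N).
    - unfold Rdiv; apply Rmult_le_compat_l; [lra|apply Rinv_le_contravar; lra].
    - apply Rle_lt_trans with ((K + 1) * / INR N).
      + unfold Rdiv; assert (0 < / INR N) by (now apply Rinv_0_lt_compat); nra.
      + replace eps with ((K + 1) * (eps / (K + 1))) by (field; lra).
        apply Rmult_lt_compat_l; lra. }
  assert (CR : forall g : C -> R, (forall a b, Rabs (g a - g b) <= Cmod (a - b)) ->
     ex_finite_lim_seq (fun n => g (u n))).
  { intros g Hg; apply ex_lim_seq_cauchy_corr; intros eps.
    destruct (Z (eps / 2)) as [N HN]; [generalize (cond_pos eps); lra|].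
    exists N; intros n m Hn Hm.
    eapply Rle_lt_trans; [apply Hg|].
    eapply Rle_lt_trans; [apply (Cmod_tri_minus _ (u N))|].
    rewrite (Cmod_minus_sym (u N)).
    generalize (T' N n Hn) (T' N m Hm) (HN N (le_n _)); lra. }
  assert (L : Climit u (Clim_seq u)).
  { destruct (CR Re) as [a Ha]; [intros p q; apply (re_le_Cmod (p - q))|].
    destruct (CR Im) as [b Hb]; [intros p q; apply (im_le_Cmod (p - q))|].
    unfold Clim_seq; rewrite (is_lim_seq_unique _ _ Ha), (is_lim_seq_unique _ _ Hb); simpl.
    apply is_lim_seq_spec in Ha; apply is_lim_seq_spec in Hb.
    intros eps He; assert (He2 : 0 < eps / 2) by lra.
    destruct (Ha (mkposreal _ He2)) as [N HN]; destruct (Hb (mkposreal _ He2)) as [N' HN'].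
    exists (Nat.max N N'); intros n Hn.
    eapply Rle_lt_trans; [apply Cmod_le_abs|].
    generalize (HN n ltac:(lia)) (HN' n ltac:(lia)); simpl; unfold Re, Im, Rminus; lra. }
  split; [exact L|].
  intros n; rewrite Cmod_minus_sym.
  apply Rnot_lt_le; intros HK.
  destruct (L (Cmod (Clim_seq u - u n) - K / (INR n + 1))) as [N HN]; [lra|].
  specialize (HN (Nat.max n N) ltac:(lia)); specialize (T' n (Nat.max n N) ltac:(lia)).
  rewrite Cmod_minus_sym in HN.
  generalize (Cmod_tri_minus (Clim_seq u) (u (Nat.max n N)) (u n)); lra.
Qed.

(** * Principal powers *)

Definition pw (z w : C) : C := Cexp (- (z * Clog w)).

Lemma pw_succ z w : 0 < Re w -> pw (z + 1) w = (pw z w / w)%C.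
Proof.
  intros H; unfold pw.
  replace (- ((z + 1) * Clog w))%C with (- (z * Clog w) + - Clog w)%C by ring.
  rewrite Cexp_plus, (Cexp_opp (Clog w)), Cexp_Clog by exact H; reflexivity.
Qed.

Lemma pw_0 w : pw 0 w = 1.
Proof.
  unfold pw; replace (- (0 * Clog w))%C with (RtoC 0) by ring; apply Cexp_0.
Qed.

Lemma pw_plus z h w : pw (z + h) w = (pw z w * Cexp (- (h * Clog w)))%C.
Proof. unfold pw; rewrite <- Cexp_plus; f_equal; ring. Qed.

Lemma Cder_pw z f t d : Cder f t d -> 0 < Re (f t) ->
  Cder (fun s => pw z (f s)) t (- z * pw (z + 1) (f t) * d)%C.
Proof.
  intros H P.
  replace (- z * pw (z + 1) (f t) * d)%C with
    (((- z) * (d / f t)) * Cexp ((- z) * Clog (f t)))%C.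
  - apply (Cder_ext (fun s => Cexp ((- z) * Clog (f s))%C)).
    { intros s; unfold pw; f_equal; ring. }
    apply Cder_Cexp, Cder_scal, Cder_Clog; assumption.
  - rewrite pw_succ by exact P; unfold pw.
    replace (- z * Clog (f t))%C with (- (z * Clog (f t)))%C by ring.
    field; now apply C_neq0_Re.
Qed.

Lemma Im_Clog_bound w : 0 < Re w -> Rabs (Im (Clog w)) <= PI / 2.
Proof.
  intros H; simpl; unfold Carg; destruct (Rlt_dec 0 (Re w)); [|tauto].
  generalize (atan_bound (Im w / Re w)); intros; apply Rabs_le; lra.
Qed.

Lemma Cmod_Clog_bound w : 0 < Re w -> Cmod (Clog w) <= Rabs (ln (Cmod w)) + 2.
Proof.
  intros H; eapply Rle_trans; [apply Cmod_le_abs|].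
  generalize (Im_Clog_bound w H) PI_4; change (Re (Clog w)) with (ln (Cmod w)); lra.
Qed.

Lemma Cmod_pw_le z w : 0 < Re w ->
  Cmod (pw z w) <= exp (2 * Rabs (Im z)) * exp (- Re z * ln (Cmod w)).
Proof.
  intros H; unfold pw; rewrite Cmod_Cexp, <- exp_plus; apply exp_le.
  replace (Re (- (z * Clog w))) with (Im z * Im (Clog w) - Re z * ln (Cmod w))
    by (unfold Re, Im; simpl; ring).
  assert (Im z * Im (Clog w) <= Rabs (Im z) * 2).
  { eapply Rle_trans; [apply Rle_abs|]; rewrite Rabs_mult.
    apply Rmult_le_compat_l; [apply Rabs_pos|].
    generalize (Im_Clog_bound w H) PI_4; lra. }
  lra.
Qed.

Lemma Cmod_pw_le' z w : Cmod (pw z w) <= exp (Cmod z * Cmod (Clog w)).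
Proof.
  unfold pw; rewrite Cmod_Cexp; apply exp_le; rewrite <- Cmod_mult, <- Cmod_opp.
  eapply Rle_trans; [apply Rle_abs|apply re_le_Cmod].
Qed.

Lemma id_le_exp x : x <= exp x.
Proof. generalize (exp_ineq1_le x); lra. Qed.

Lemma Cmod_sq_le_exp v : Cmod v * Cmod v <= 4 * exp (Cmod v).
Proof.
  replace (exp (Cmod v)) with (exp (Cmod v / 2) * exp (Cmod v / 2))
    by (rewrite <- exp_plus; f_equal; field).
  generalize (id_le_exp (Cmod v / 2)) (Cmod_ge_0 v); nra.
Qed.

Lemma pw_taylor z h w : Cmod h <= 1 ->
  Cmod (pw (z + h) w - pw z w - h * (- Clog w * pw z w)) <=
  16 * (Cmod h * Cmod h) * (Cmod (pw z w) * exp (2 * Cmod (Clog w))).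
Proof.
  intros Hh; rewrite pw_plus; set (v := (- (h * Clog w))%C).
  replace (_ - _ - _)%C with (pw z w * (Cexp v - 1 - v))%C by (unfold v; ring).
  rewrite Cmod_mult.
  assert (Ev : Cmod v = Cmod h * Cmod (Clog w)) by (unfold v; now rewrite Cmod_opp, Cmod_mult).
  assert (P := Cmod_ge_0 (Clog w)); assert (Ph := Cmod_ge_0 h).
  assert (Cmod (Cexp v - 1 - v) <= 16 * (Cmod h * Cmod h) * exp (2 * Cmod (Clog w))).
  { eapply Rle_trans; [apply Cexp_bound2|].
    replace (exp (2 * Cmod (Clog w))) with (exp (Cmod (Clog w)) * exp (Cmod (Clog w)))
      by (rewrite <- exp_plus; f_equal; ring).
    replace (4 * _) with (4 * (Cmod h * Cmod h) * ((Cmod (Clog w) * Cmod (Clog w)) * exp (Cmod v)))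
      by (rewrite Ev; ring).
    replace (16 * _ * _) with (4 * (Cmod h * Cmod h) * ((4 * exp (Cmod (Clog w))) * exp (Cmod (Clog w)))) by ring.
    apply Rmult_le_compat_l; [nra|].
    apply Rmult_le_compat; [nra|left; apply exp_pos|apply Cmod_sq_le_exp|].
    apply exp_le; rewrite Ev; nra. }
  generalize (Cmod_ge_0 (pw z w)); nra.
Qed.

(* Series are compared with [1 / ((n+1)(n+2))] because it telescopes. *)
Lemma inv_sq_decay a m n : 0 < a -> INR n + a <= m ->
  / (m * m) <= 2 * (1 + / a) * (1 + / a) / ((INR n + 1) * (INR n + 2)).
Proof.
  intros Ha Hm; assert (Pn := pos_INR n); assert (Ia := Rinv_0_lt_compat _ Ha).
  assert (G : INR n + 1 <= m * (1 + / a)).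
  { apply Rle_trans with ((INR n + a) * (1 + / a)).
    - replace ((INR n + a) * (1 + / a)) with (INR n + 1 + a + INR n * / a) by (field; lra). nra.
    - apply Rmult_le_compat_r; lra. }
  apply Rmult_le_reg_r with ((m * m) * ((INR n + 1) * (INR n + 2))); [nra|].
  replace (/ (m * m) * (m * m * ((INR n + 1) * (INR n + 2)))) with
    ((INR n + 1) * (INR n + 2)) by (field; lra).
  replace (2 * (1 + / a) * (1 + / a) / ((INR n + 1) * (INR n + 2)) *
    (m * m * ((INR n + 1) * (INR n + 2)))) with
    (2 * ((m * (1 + / a)) * (m * (1 + / a)))) by (field; lra).
  nra.
Qed.

Lemma pw_decay a z : 0 < a -> 4 < Re z ->
  exists K, forall n w, INR n + a <= Re w ->
    Cmod (pw z w) * exp (2 * Cmod (Clog w)) <= K / ((INR n + 1) * (INR n + 2)).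
Proof.
  intros Ha Hz; set (s := Re z) in *; set (A := Rabs (ln a)).
  set (c := exp (2 * Rabs (Im z)) * exp (4 * A + 4 + (s - 4) * A)).
  exists (c * (2 * (1 + / a) * (1 + / a))); intros n w Hw.
  assert (Pn := pos_INR n).
  assert (Hw0 : 0 < Re w) by lra.
  assert (Mw : Re w <= Cmod w) by (generalize (re_le_Cmod w) (Rle_abs (Re w)); lra).
  assert (P := Cmod_pos_Re _ Hw0).
  set (L := ln (Cmod w)).
  assert (HL : ln a <= L) by (apply ln_le; lra).
  assert (HA : - A <= L) by (unfold A; generalize (Rle_abs (- ln a)); rewrite Rabs_Ropp; lra).
  assert (A0 : 0 <= A) by apply Rabs_pos.
  assert (HAL : Rabs L <= L + 2 * A) by (apply Rabs_le; lra).
  assert (B1 : Cmod (pw z w) * exp (2 * Cmod (Clog w)) <=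
    exp (2 * Rabs (Im z)) * exp (- s * L) * exp (2 * (L + 2 * A + 2))).
  { apply Rmult_le_compat; [apply Cmod_ge_0|left; apply exp_pos|now apply Cmod_pw_le|].
    apply exp_le; generalize (Cmod_Clog_bound w Hw0); fold L; lra. }
  assert (B2 : exp (2 * Rabs (Im z)) * exp (- s * L) * exp (2 * (L + 2 * A + 2)) <=
    c * exp (- (L + L))).
  { unfold c; rewrite !Rmult_assoc, <- !exp_plus; apply exp_le.
    assert (0 <= (s - 4) * (L + A)) by (apply Rmult_le_pos; lra). lra. }
  rewrite exp_Ropp, exp_plus in B2; unfold L in B2; rewrite exp_ln in B2 by exact P.
  eapply Rle_trans; [exact B1|]; eapply Rle_trans; [exact B2|].
  assert (c0 : 0 < c) by (apply Rmult_lt_0_compat; apply exp_pos).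
  replace (c * (2 * (1 + / a) * (1 + / a)) / ((INR n + 1) * (INR n + 2))) with
    (c * (2 * (1 + / a) * (1 + / a) / ((INR n + 1) * (INR n + 2)))) by (field; lra).
  apply Rmult_le_compat_l; [lra|].
  apply inv_sq_decay; lra.
Qed.

(** * Partial sums *)

Fixpoint Csum (a : nat -> C) (N : nat) : C :=
  match N with O => 0 | S n => (Csum a n + a n)%C end.

Lemma Csum_ext a b N : (forall n, a n = b n) -> Csum a N = Csum b N.
Proof. intros E; induction N as [|N IH]; simpl; [|rewrite IH, E]; reflexivity. Qed.

Lemma Csum_scal c a N : Csum (fun n => (c * a n)%C) N = (c * Csum a N)%C.
Proof. induction N as [|N IH]; simpl; [|rewrite IH]; ring. Qed.

Lemma Csum_bound a K N : 0 <= K ->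
  (forall n, Cmod (a n) <= K / ((INR n + 1) * (INR n + 2))) -> Cmod (Csum a N) <= K.
Proof.
  intros K0 H; apply Rle_trans with (K - K / (INR N + 1)).
  - induction N as [|N IH].
    + simpl; rewrite Cmod_0; apply Req_le; field.
    + simpl Csum; eapply Rle_trans; [apply Cmod_triangle|].
      specialize (H N); rewrite S_INR; assert (Q := pos_INR N).
      replace (K / ((INR N + 1) * (INR N + 2))) with
        (K / (INR N + 1) - K / (INR N + 1 + 1)) in H by (field; lra).
      lra.
  - assert (0 <= K / (INR N + 1)); [|lra].
    apply Rdiv_le_0_compat; [lra|generalize (pos_INR N); lra].
Qed.

Lemma Cder_Csum (a : nat -> R -> C) da t N : (forall n, Cder (a n) t (da n)) ->
  Cder (fun s => Csum (fun n => a n s) N) t (Csum da N).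
Proof.
  intros H; induction N as [|N IH]; simpl; [apply Cder_const|now apply Cder_plus].
Qed.

Definition sg (n : nat) : C := RtoC ((-1) ^ n).

Lemma sg_S n : sg (S n) = (- sg n)%C.
Proof. unfold sg; simpl; rewrite RtoC_mult; ring. Qed.

Lemma Cmod_sg n : Cmod (sg n) = 1.
Proof. unfold sg; rewrite Cmod_R; apply pow_1_abs. Qed.

Definition sh (n : nat) (x : C) : C := (RtoC (INR n) + x)%C.

Lemma Re_sh n x : Re (sh n x) = INR n + Re x.
Proof. reflexivity. Qed.

Lemma sh_succ n r y : sh n (r + 1, y) = sh (S n) (r, y).
Proof. unfold sh; rewrite S_INR; apply C_ext; simpl; ring. Qed.

Lemma Re_sh_pos n x : 0 < Re x -> 0 < Re (sh n x).
Proof. rewrite Re_sh; generalize (pos_INR n); lra. Qed.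

Lemma Cder_sh n y r : Cder (fun s => sh n (s, y)) r 1.
Proof.
  replace (RtoC 1) with (0 + 1)%C by ring.
  apply Cder_plus; [apply Cder_const|apply Cder_shift].
Qed.

Definition zS (z x : C) (N : nat) : C := Csum (fun n => (sg n * pw z (sh n x))%C) N.

Lemma Cder_zS z r y N : 0 < r -> 
  Cder (fun s => zS z (s, y) N) r (- z * zS (z + 1) (r, y) N)%C.
Proof.
  intros H; unfold zS; rewrite <- Csum_scal.
  apply (Cder_Csum (fun n s => (sg n * pw z (sh n (s, y)))%C)); intros n.
  replace (- z * (sg n * pw (z + 1) (sh n (r, y))))%C with
    (sg n * (- z * pw (z + 1) (sh n (r, y)) * 1))%C by ring.
  apply Cder_scal.
  apply (Cder_pw z (fun s => sh n (s, y))); [apply Cder_sh|now apply Re_sh_pos].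
Qed.

Lemma zS_shift z r y N :
  zS z (r + 1, y) N = (pw z (r, y) - sg N * pw z (sh N (r, y)) - zS z (r, y) N)%C.
Proof.
  induction N as [|N IH].
  - unfold zS; simpl; replace (sh 0 (r, y)) with ((r, y) : C).
    + unfold sg; simpl; ring.
    + unfold sh; apply C_ext; simpl; ring.
  - unfold zS in *; simpl Csum; rewrite IH, sh_succ, sg_S; ring.
Qed.

(** * Integrals over unit intervals *)

Lemma Ccont_ext f g t : (forall s, f s = g s) -> Ccont f t -> Ccont g t.
Proof.
  intros E [H1 H2]; split; [apply (continuous_ext _ _ _ (fun s => f_equal Re (E s)) H1)
    |apply (continuous_ext _ _ _ (fun s => f_equal Im (E s)) H2)].
Qed.

Lemma Ccont_const c t : Ccont (fun _ => c) t.
Proof. eapply Cder_cont, Cder_const. Qed.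

Lemma Ccont_plus f g t : Ccont f t -> Ccont g t -> Ccont (fun s => (f s + g s)%C) t.
Proof.
  intros [H1 H2] [H3 H4]; split; [apply (continuous_plus _ _ _ H1 H3)|apply (continuous_plus _ _ _ H2 H4)].
Qed.

Lemma Ccont_mult f g t : Ccont f t -> Ccont g t -> Ccont (fun s => (f s * g s)%C) t.
Proof.
  intros [H1 H2] [H3 H4]; split.
  - exact (continuous_minus _ _ _ (continuous_mult _ _ _ H1 H3) (continuous_mult _ _ _ H2 H4)).
  - exact (continuous_plus _ _ _ (continuous_mult _ _ _ H1 H4) (continuous_mult _ _ _ H2 H3)).
Qed.

Lemma Ccont_minus f g t : Ccont f t -> Ccont g t -> Ccont (fun s => (f s - g s)%C) t.
Proof.
  intros [H1 H2] [H3 H4]; split; [apply (continuous_minus _ _ _ H1 H3)|apply (continuous_minus _ _ _ H2 H4)].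
Qed.

Definition Ccont_on (f : R -> C) (a b : R) : Prop := forall s, a <= s <= b -> Ccont f s.

Lemma Ccont_ex_RInt f a b : a <= b -> Ccont_on f a b ->
  ex_RInt (fun s => Re (f s)) a b /\ ex_RInt (fun s => Im (f s)) a b.
Proof.
  intros Hab H; split; apply (ex_RInt_continuous (V := R_CompleteNormedModule));
    rewrite Rmin_left, Rmax_right by exact Hab; intros s Hs; apply (H s Hs).
Qed.

Lemma Cint_scal c f a b : a <= b -> Ccont_on f a b ->
  Cint (fun s => (c * f s)%C) a b = (c * Cint f a b)%C.
Proof.
  intros Hab Hf; destruct (Ccont_ex_RInt _ _ _ Hab Hf) as [I1 I2].
  assert (K : forall (k : R) (g : R -> R), ex_RInt g a b -> is_RInt (fun s => k * g s) a b (k * RInt g a b)).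
  { intros k g Hg; exact (is_RInt_scal g a b k _ (RInt_correct (V := R_CompleteNormedModule) g a b Hg)). }
  apply C_ext; apply (is_RInt_unique (V := R_CompleteNormedModule)).
  - exact (is_RInt_minus _ _ _ _ _ _ (K (Re c) _ I1) (K (Im c) _ I2)).
  - exact (is_RInt_plus _ _ _ _ _ _ (K (Re c) _ I2) (K (Im c) _ I1)).
Qed.

Lemma Cint_minus f g a b : a <= b -> Ccont_on f a b -> Ccont_on g a b ->
  Cint (fun s => (f s - g s)%C) a b = (Cint f a b - Cint g a b)%C.
Proof.
  intros Hab Hf Hg; destruct (Ccont_ex_RInt _ _ _ Hab Hf), (Ccont_ex_RInt _ _ _ Hab Hg).
  apply C_ext; simpl.
  - now apply (RInt_minus (V := R_CompleteNormedModule)).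
  - now apply (RInt_minus (V := R_CompleteNormedModule)).
Qed.

Lemma Cint_bound f a b M : a <= b -> Ccont_on f a b ->
  (forall s, a <= s <= b -> Cmod (f s) <= M) -> Cmod (Cint f a b) <= 2 * ((b - a) * M).
Proof.
  intros Hab Hf B; destruct (Ccont_ex_RInt _ _ _ Hab Hf) as [I1 I2].
  eapply Rle_trans; [apply Cmod_le_abs|].
  assert (Rabs (Re (Cint f a b)) <= (b - a) * M).
  { apply abs_RInt_le_const; auto; intros; eapply Rle_trans; [apply re_le_Cmod|auto]. }
  assert (Rabs (Im (Cint f a b)) <= (b - a) * M).
  { apply abs_RInt_le_const; auto; intros; eapply Rle_trans; [apply im_le_Cmod|auto]. }
  lra.
Qed.

Lemma Cint_FTC f df a b : a <= b -> (forall s, a <= s <= b -> Cder f s (df s)) ->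
  Ccont_on df a b -> Cint df a b = (f b - f a)%C.
Proof.
  intros Hab H Hc.
  apply C_ext; apply (is_RInt_unique (V := R_CompleteNormedModule)).
  - apply (is_RInt_derive (fun s => Re (f s)) (fun s => Re (df s)));
      rewrite Rmin_left, Rmax_right by exact Hab; intros s Hs; [apply (H s Hs)|apply (Hc s Hs)].
  - apply (is_RInt_derive (fun s => Im (f s)) (fun s => Im (df s)));
      rewrite Rmin_left, Rmax_right by exact Hab; intros s Hs; [apply (H s Hs)|apply (Hc s Hs)].
Qed.

Definition Iu (f : R -> C) (r : R) : C := Cint f r (r + 1).

Lemma continuous_RInt_unit (g : R -> R) r : 0 < r -> (forall s, 0 < s -> continuous g s) ->
  continuous (fun t => RInt g t (t + 1)) r.
Proof.
  intros Hr Hg.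
  assert (X : forall a b, 0 < a -> 0 < b -> ex_RInt g a b).
  { intros a b Ha Hb; apply (ex_RInt_continuous (V := R_CompleteNormedModule)); intros s Hs.
    apply Hg; generalize (Rmin_glb_lt _ _ _ Ha Hb); lra. }
  assert (D : forall t, 0 < t -> is_derive (fun b => RInt g 1 b) t (g t)).
  { intros t Ht; apply (is_derive_RInt g (fun b => RInt g 1 b) 1); [|now apply Hg].
    apply filter_imp with (fun b => 0 < b); [|now apply (open_gt 0)].
    intros b Hb; apply (RInt_correct (V := R_CompleteNormedModule)), X; lra. }
  assert (E : forall t, 0 < t -> RInt g t (t + 1) = RInt g 1 (t + 1) - RInt g 1 t).
  { intros t Ht; generalize (RInt_Chasles g 1 t (t + 1) (X _ _ Rlt_0_1 Ht) (X t (t + 1) Ht ltac:(lra))).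
    unfold plus; simpl; lra. }
  apply continuous_ext_loc with (fun t => RInt g 1 (t + 1) - RInt g 1 t).
  { apply filter_imp with (fun b => 0 < b); [|now apply (open_gt 0)].
    intros t Ht; simpl; now rewrite E. }
  eapply is_derive_cont, is_derive_Rminus; [|now apply D].
  apply (is_derive_Rcomp (fun b => RInt g 1 b) (fun t => t + 1)); [apply D; lra|].
  auto_derive; [auto|reflexivity].
Qed.

Lemma Ccont_Iu f r : 0 < r -> (forall s, 0 < s -> Ccont f s) -> Ccont (Iu f) r.
Proof.
  intros Hr H; split; apply continuous_RInt_unit; auto; intros s Hs; apply (H s Hs).
Qed.

Lemma Ccont_pos_on f a b : 0 < a -> (forall s, 0 < s -> Ccont f s) -> Ccont_on f a b.
Proof. intros Ha H s Hs; apply H; lra. Qed.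

Lemma Iu_bound f r M : 0 < r -> (forall s, 0 < s -> Ccont f s) ->
  (forall s, r <= s <= r + 1 -> Cmod (f s) <= M) -> Cmod (Iu f r) <= 2 * M.
Proof.
  intros Hr H B; replace (2 * M) with (2 * ((r + 1 - r) * M)) by ring.
  apply Cint_bound; auto using Ccont_pos_on; lra.
Qed.

(** * Families depending holomorphically on [z], uniformly in [r] *)

(* Complex differentiability at [z] of the family [F], with a quadratic
   remainder that is uniform on compact sets of [r]: this form survives both
   integration in [r] and limits of series, without any Cauchy theory. *)
Definition udiff (F : C -> R -> C) (z : C) (D : R -> C) : Prop :=
  (forall r, 0 < r -> Ccont (F z) r) /\ (forall r, 0 < r -> Ccont D r) /\
  forall a b, 0 < a -> a <= b -> exists M d, 0 <= M /\ 0 < d /\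
    forall r, a <= r <= b -> Cmod (F z r) <= M /\ Cmod (D r) <= M /\
      forall h, Cmod h < d -> Cmod (F (z + h)%C r - F z r - h * D r) <= M * (Cmod h * Cmod h).

Lemma udiff_plus F G z D E : udiff F z D -> udiff G z E ->
  udiff (fun z r => (F z r + G z r)%C) z (fun r => (D r + E r)%C).
Proof.
  intros (C1 & C2 & H) (C3 & C4 & K); split; [|split].
  1,2: intros; apply Ccont_plus; auto.
  intros a b Ha Hab; destruct (H a b Ha Hab) as (M & d & M0 & d0 & B).
  destruct (K a b Ha Hab) as (M' & d' & M0' & d0' & B').
  exists (M + M'), (Rmin d d'); split; [lra|]; split; [now apply Rmin_pos|].
  intros r Hr; destruct (B r Hr) as (B1 & B2 & B3); destruct (B' r Hr) as (B1' & B2' & B3').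
  split; [eapply Rle_trans; [apply Cmod_triangle|]; lra|].
  split; [eapply Rle_trans; [apply Cmod_triangle|]; lra|].
  intros h Hh.
  specialize (B3 h (Rlt_le_trans _ _ _ Hh (Rmin_l _ _))).
  specialize (B3' h (Rlt_le_trans _ _ _ Hh (Rmin_r _ _))).
  replace (_ - _ - _)%C with ((F (z + h)%C r - F z r - h * D r) + (G (z + h)%C r - G z r - h * E r))%C by ring.
  eapply Rle_trans; [apply Cmod_triangle|]; lra.
Qed.

Lemma udiff_scal c F z D : udiff F z D ->
  udiff (fun z r => (c * F z r)%C) z (fun r => (c * D r)%C).
Proof.
  intros (C1 & C2 & H); split; [|split].
  1,2: intros; apply Ccont_mult; auto using Ccont_const.
  intros a b Ha Hab; destruct (H a b Ha Hab) as (M & d & M0 & d0 & B).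
  assert (P := Cmod_ge_0 c).
  exists (Cmod c * M), d; split; [nra|]; split; [auto|].
  intros r Hr; destruct (B r Hr) as (B1 & B2 & B3).
  rewrite !Cmod_mult; split; [nra|]; split; [nra|].
  intros h Hh; specialize (B3 h Hh).
  replace (_ - _ - _)%C with (c * (F (z + h)%C r - F z r - h * D r))%C by ring.
  rewrite Cmod_mult; nra.
Qed.

Lemma udiff_mulz F z D : udiff F z D ->
  udiff (fun z r => (z * F z r)%C) z (fun r => (F z r + z * D r)%C).
Proof.
  intros (C1 & C2 & H); split; [|split].
  - intros; apply Ccont_mult; auto using Ccont_const.
  - intros; apply Ccont_plus; auto; apply Ccont_mult; auto using Ccont_const.
  - intros a b Ha Hab; destruct (H a b Ha Hab) as (M & d & M0 & d0 & B).
    assert (P := Cmod_ge_0 z).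
    exists ((Cmod z + 1) * M + M), (Rmin d 1); split; [nra|]; split; [apply Rmin_pos; lra|].
    intros r Hr; destruct (B r Hr) as (B1 & B2 & B3).
    rewrite Cmod_mult; split; [nra|]; split.
    { eapply Rle_trans; [apply Cmod_triangle|]; rewrite Cmod_mult; nra. }
    intros h Hh.
    specialize (B3 h (Rlt_le_trans _ _ _ Hh (Rmin_l _ _))).
    assert (Hh1 := Rlt_le_trans _ _ _ Hh (Rmin_r _ _)).
    replace (_ - _ - _)%C with ((z + h) * (F (z + h)%C r - F z r - h * D r) + h * h * D r)%C by ring.
    eapply Rle_trans; [apply Cmod_triangle|]; rewrite !Cmod_mult.
    assert (Q := Cmod_triangle z h); assert (P' := Cmod_ge_0 (z + h)); assert (P'' := Cmod_ge_0 h).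
    assert (Cmod (z + h) * Cmod (F (z + h)%C r - F z r - h * D r) <= (Cmod z + 1) * (M * (Cmod h * Cmod h))).
    { apply Rmult_le_compat; auto using Cmod_ge_0; lra. }
    assert (Cmod h * Cmod h * Cmod (D r) <= Cmod h * Cmod h * M).
    { apply Rmult_le_compat_l; nra. }
    lra.
Qed.

Lemma udiff_Iu F z D : udiff F (z + 1) D ->
  (exists e, 0 < e /\ forall h, Cmod h < e -> forall r, 0 < r -> Ccont (F (z + 1 + h)%C) r) ->
  udiff (fun z r => Iu (F (z + 1)%C) r) z (Iu D).
Proof.
  intros (C1 & C2 & H) (e & e0 & He); split; [|split].
  1,2: intros; now apply Ccont_Iu.
  intros a b Ha Hab; destruct (H a (b + 1) Ha) as (M & d & M0 & d0 & B); [lra|].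
  exists (2 * M), (Rmin d e); split; [lra|]; split; [now apply Rmin_pos|].
  intros r Hr.
  assert (Hr0 : 0 < r) by lra.
  split; [apply Iu_bound; auto; intros; apply B; lra|].
  split; [apply Iu_bound; auto; intros; apply B; lra|].
  intros h Hh.
  assert (Hd := Rlt_le_trans _ _ _ Hh (Rmin_l _ _)).
  assert (Hee := Rlt_le_trans _ _ _ Hh (Rmin_r _ _)).
  assert (C3 : forall s, 0 < s -> Ccont (F (z + h + 1)%C) s).
  { replace (z + h + 1)%C with (z + 1 + h)%C by ring; now apply He. }
  replace (_ - _ - _)%C with (Iu (fun s => (F (z + h + 1)%C s - F (z + 1)%C s - h * D s)%C) r).
  - replace (2 * M * _) with (2 * (M * (Cmod h * Cmod h))) by ring.
    apply Iu_bound; auto.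
    + intros s Hs; apply Ccont_minus; [apply Ccont_minus; auto|].
      apply Ccont_mult; auto using Ccont_const.
    + intros s Hs; replace (z + h + 1)%C with (z + 1 + h)%C by ring; apply B; auto; lra.
  - unfold Iu; rewrite Cint_minus, Cint_minus, Cint_scal; auto using Ccont_pos_on; try lra.
    + apply Ccont_pos_on; auto; intros s Hs; apply Ccont_minus; auto.
    + apply Ccont_pos_on; auto; intros s Hs; apply Ccont_mult; auto using Ccont_const.
Qed.

Lemma Cder_Clog_line y r : 0 < r -> Cder (fun s => Clog (s, y)) r (1 / (r, y))%C.
Proof. intros H; apply (Cder_Clog (fun s => (s, y))); [apply Cder_shift|exact H]. Qed.

Lemma Cder_pw_line z y r : 0 < r -> Cder (fun s => pw z (s, y)) r (- z * pw (z + 1) (r, y))%C.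
Proof.
  intros H; replace (- z * pw (z + 1) (r, y))%C with (- z * pw (z + 1) (r, y) * 1)%C by ring.
  apply (Cder_pw z (fun s => (s, y))); [apply Cder_shift|exact H].
Qed.

Lemma Clog_line_bound y a b : 0 < a -> a <= b ->
  exists B, 0 <= B /\ forall r, a <= r <= b -> Cmod (Clog (r, y)) <= B.
Proof.
  intros Ha Hab; exists (Rabs (ln a) + Rabs (ln (b + Rabs y)) + 2).
  assert (Py := Rabs_pos y).
  generalize (Rabs_pos (ln a)) (Rabs_pos (ln (b + Rabs y))); intros P1 P2; split; [lra|].
  intros r Hr; assert (Hr0 : 0 < Re (r, y)) by (simpl; lra).
  eapply Rle_trans; [now apply Cmod_Clog_bound|].
  assert (L1 : a <= Cmod (r, y)).
  { generalize (re_le_Cmod (r, y)) (Rle_abs (Re (r, y))); simpl; lra. }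
  assert (L2 : Cmod (r, y) <= b + Rabs y).
  { eapply Rle_trans; [apply Cmod_le_abs|]; simpl; rewrite (Rabs_pos_eq r) by lra; lra. }
  apply ln_le in L1; [|exact Ha]; apply ln_le in L2; [|now apply Cmod_pos_Re].
  generalize (Rle_abs (- ln a)) (Rle_abs (ln (b + Rabs y))); rewrite Rabs_Ropp; intros.
  assert (Rabs (ln (Cmod (r, y))) <= Rabs (ln a) + Rabs (ln (b + Rabs y))); [|lra].
  apply Rabs_le; lra.
Qed.

Lemma udiff_pw y z :
  udiff (fun z r => pw z (r, y)) z (fun r => (- Clog (r, y) * pw z (r, y))%C).
Proof.
  split; [|split].
  - intros r Hr; eapply Cder_cont, Cder_pw_line, Hr.
  - intros r Hr; apply Ccont_mult; [|eapply Cder_cont, Cder_pw_line, Hr].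
    apply (Ccont_ext (fun s => (0 - Clog (s, y))%C)); [intros; ring|].
    apply Ccont_minus; [apply Ccont_const|eapply Cder_cont, Cder_Clog_line, Hr].
  - intros a b Ha Hab; destruct (Clog_line_bound y a b Ha Hab) as (B & B0 & HB).
    set (m := exp (Cmod z * B)); assert (Pm : 0 < m) by apply exp_pos.
    set (m' := exp (2 * B)); assert (Pm' : 0 < m') by apply exp_pos.
    assert (0 < m * m') by nra.
    exists (m + B * m + 16 * (m * m')), 1; split; [nra|]; split; [lra|].
    intros r Hr; specialize (HB r Hr).
    assert (Bp : Cmod (pw z (r, y)) <= m).
    { eapply Rle_trans; [apply Cmod_pw_le'|]; apply exp_le.
      apply Rmult_le_compat_l; [apply Cmod_ge_0|exact HB]. }
    assert (P1 := Cmod_ge_0 (pw z (r, y))); assert (P2 := Cmod_ge_0 (Clog (r, y))).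
    split; [nra|]; split; [rewrite Cmod_mult, Cmod_opp; nra|].
    intros h Hh; eapply Rle_trans; [apply pw_taylor; lra|].
    assert (Ph := Cmod_ge_0 h); set (hh := Cmod h * Cmod h); assert (0 <= hh) by (unfold hh; nra).
    assert (Cmod (pw z (r, y)) * exp (2 * Cmod (Clog (r, y))) <= m * m').
    { apply Rmult_le_compat; auto; [left; apply exp_pos|apply exp_le; lra]. }
    apply Rle_trans with (16 * hh * (m * m')); [apply Rmult_le_compat_l; lra|].
    assert (0 <= hh * (m + B * m)) by (apply Rmult_le_pos; nra); lra.
Qed.

(** * Analytic continuation of the alternating Hurwitz zeta function *)

Definition zS_conv (y : R) (z : C) (V : R -> C) : Prop :=
  forall a b eps, 0 < a -> a <= b -> 0 < eps -> exists N, forall n r, (N <= n)%nat ->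
    a <= r <= b -> Cmod (zS z (r, y) n - V r) <= eps.

Lemma zS_conv_Climit y z V r : 0 < r -> zS_conv y z V -> Climit (zS z (r, y)) (V r).
Proof.
  intros Hr H eps He; destruct (H r r (eps / 2) Hr) as [N HN]; [lra|lra|].
  exists N; intros n Hn; specialize (HN n r Hn ltac:(lra)); lra.
Qed.

Lemma inv_INR_small K eps : 0 <= K -> 0 < eps ->
  exists N, forall n, (N <= n)%nat -> K / (INR n + 1) < eps.
Proof.
  intros K0 He; destruct (INR_unbounded (K / eps)) as [N HN].
  exists N; intros n Hn; apply le_INR in Hn.
  assert (P := pos_INR N).
  apply Rmult_lt_reg_r with (INR n + 1); [lra|].
  replace (K / (INR n + 1) * (INR n + 1)) with (K / eps * eps) by (field; lra).
  rewrite (Rmult_comm eps); apply Rmult_lt_compat_r; lra.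
Qed.

Lemma Ccont_uniform_limit (U : nat -> R -> C) (V : R -> C) a b K : 0 <= K ->
  (forall N s, a <= s <= b -> Ccont (U N) s) ->
  (forall N s, a <= s <= b -> Cmod (U N s - V s) <= K / (INR N + 1)) ->
  forall r, a < r < b -> Ccont V r.
Proof.
  intros K0 HU HV r Hr.
  assert (G : forall g : C -> R, (forall p q, Rabs (g p - g q) <= Cmod (p - q)) ->
    (forall N, continuous (fun s => g (U N s)) r) -> continuous (fun s => g (V s)) r).
  { intros g Hg Hc; apply filterlim_locally; intros eps.
    assert (He : 0 < eps / 3) by (generalize (cond_pos eps); lra).
    destruct (inv_INR_small K (eps / 3) K0 He) as [N HN]; specialize (HN N (le_n _)).
    specialize (Hc N); apply filterlim_locally with (eps := mkposreal _ He) in Hc.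
    assert (L : locally r (fun s => a < s < b)).
    { apply filter_and; [apply (open_gt a)|apply (open_lt b)]; apply Hr. }
    generalize (filter_and _ _ Hc L); apply filter_imp; intros s [Hs1 Hs2].
    change (Rabs (g (U N s) - g (U N r)) < eps / 3) in Hs1.
    change (Rabs (g (V s) - g (V r)) < eps).
    assert (B1 := Hg (U N s) (V s)); assert (B2 := Hg (U N r) (V r)).
    assert (B3 := HV N s ltac:(lra)); assert (B4 := HV N r ltac:(lra)).
    replace (g (V s) - g (V r)) with
      (- (g (U N s) - g (V s)) + ((g (U N s) - g (U N r)) + (g (U N r) - g (V r)))) by ring.
    eapply Rle_lt_trans; [apply Rabs_triang|]; rewrite Rabs_Ropp.
    generalize (Rabs_triang (g (U N s) - g (U N r)) (g (U N r) - g (V r))); lra. }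
  split.
  - apply (G Re); [intros p q; apply (re_le_Cmod (p - q))|].
    intros N; exact (proj1 (HU N r ltac:(lra))).
  - apply (G Im); [intros p q; apply (im_le_Cmod (p - q))|].
    intros N; exact (proj2 (HU N r ltac:(lra))).
Qed.

Definition zF0 (y : R) (z : C) (r : R) : C := Clim_seq (zS z (r, y)).

Definition zSd (z x : C) (N : nat) : C :=
  Csum (fun n => (sg n * (- Clog (sh n x) * pw z (sh n x)))%C) N.

Definition zD0 (y : R) (z : C) (r : R) : C := Clim_seq (zSd z (r, y)).

Lemma Ccont_Csum (a : nat -> R -> C) t N : (forall n, Ccont (a n) t) ->
  Ccont (fun s => Csum (fun n => a n s) N) t.
Proof.
  intros H; induction N as [|N IH]; simpl; [apply Ccont_const|now apply Ccont_plus].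
Qed.

Lemma zS_telescope z a : 0 < a -> 4 < Re z -> exists K, 0 <= K /\
  forall r y, a <= r ->
    (forall n, Cmod (pw z (sh n (r, y))) * exp (2 * Cmod (Clog (sh n (r, y)))) <=
       K / ((INR n + 1) * (INR n + 2))) /\
    (forall n, Cmod (zS z (r, y) (S n) - zS z (r, y) n) <= K / ((INR n + 1) * (INR n + 2))) /\
    (forall n, Cmod (zSd z (r, y) (S n) - zSd z (r, y) n) <= K / ((INR n + 1) * (INR n + 2))).
Proof.
  intros Ha Hz; destruct (pw_decay a z Ha Hz) as [K HK].
  assert (K' : forall r y n, a <= r ->
    Cmod (pw z (sh n (r, y))) * exp (2 * Cmod (Clog (sh n (r, y)))) <= K / ((INR n + 1) * (INR n + 2))).
  { intros r y n Hr; apply HK; rewrite Re_sh; simpl; lra. }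
  assert (E : forall w, 1 <= exp (2 * Cmod w) /\ Cmod w <= exp (2 * Cmod w)).
  { intros w; generalize (exp_ineq1_le (2 * Cmod w)) (Cmod_ge_0 w); lra. }
  exists K; split.
  { specialize (K' a 0 0%nat (Rle_refl _)); simpl in K'.
    assert (0 <= Cmod (pw z (sh 0 (a, 0))) * exp (2 * Cmod (Clog (sh 0 (a, 0))))); [|lra].
    apply Rmult_le_pos; [apply Cmod_ge_0|left; apply exp_pos]. }
  intros r y Hr; split; [|split]; intros n; [now apply K'| |];
    eapply Rle_trans; try apply (K' r y n Hr); destruct (E (Clog (sh n (r, y)))) as [E1 E2];
    assert (P := Cmod_ge_0 (pw z (sh n (r, y)))).
  - unfold zS; simpl Csum.
    replace (_ - _)%C with (sg n * pw z (sh n (r, y)))%C by ring.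
    rewrite Cmod_mult, Cmod_sg; nra.
  - unfold zSd; simpl Csum.
    replace (_ - _)%C with (sg n * (- Clog (sh n (r, y)) * pw z (sh n (r, y))))%C by ring.
    rewrite !Cmod_mult, Cmod_sg, Cmod_opp; nra.
Qed.

Lemma zF0_rate y z a : 0 < a -> 4 < Re z -> exists K, 0 <= K /\ forall r, a <= r ->
  (forall n, Cmod (pw z (sh n (r, y))) * exp (2 * Cmod (Clog (sh n (r, y)))) <=
       K / ((INR n + 1) * (INR n + 2))) /\
  Climit (zS z (r, y)) (zF0 y z r) /\ Climit (zSd z (r, y)) (zD0 y z r) /\
  (forall n, Cmod (zS z (r, y) n - zF0 y z r) <= K / (INR n + 1)) /\
  (forall n, Cmod (zSd z (r, y) n - zD0 y z r) <= K / (INR n + 1)).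
Proof.
  intros Ha Hz; destruct (zS_telescope z a Ha Hz) as (K & K0 & H).
  exists K; split; [exact K0|]; intros r Hr; destruct (H r y Hr) as (H1 & H2 & H3).
  apply Climit_telescope in H2; apply Climit_telescope in H3; tauto.
Qed.

Lemma zF0_conv y z : 4 < Re z -> zS_conv y z (zF0 y z).
Proof.
  intros Hz a b eps Ha Hab He; destruct (zF0_rate y z a Ha Hz) as (K & K0 & H).
  destruct (inv_INR_small K eps K0 He) as [N HN].
  exists N; intros n r Hn Hr; destruct (H r (proj1 Hr)) as (_ & _ & _ & B & _).
  specialize (B n); specialize (HN n Hn); lra.
Qed.

Lemma zF0_cont y z r : 4 < Re z -> 0 < r -> Ccont (zF0 y z) r /\ Ccont (zD0 y z) r.
Proof.
  intros Hz Hr; destruct (zF0_rate y z (r / 2)) as (K & K0 & H); [lra|auto|].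
  split.
  - apply Ccont_uniform_limit with (fun N s => zS z (s, y) N) (r / 2) (r + 1) K; auto; try lra.
    + intros N s Hs; eapply Cder_cont, Cder_zS; lra.
    + intros N s Hs; now apply H.
  - apply Ccont_uniform_limit with (fun N s => zSd z (s, y) N) (r / 2) (r + 1) K; auto; try lra.
    + intros N s Hs; unfold zSd.
      apply (Ccont_Csum (fun n s => (sg n * (- Clog (sh n (s, y)) * pw z (sh n (s, y))))%C)).
      intros n; assert (0 < Re (sh n (s, y))) by (apply Re_sh_pos; simpl; lra).
      apply Ccont_mult; [apply Ccont_const|]; apply Ccont_mult.
      * apply (Ccont_ext (fun s => (0 - Clog (sh n (s, y)))%C)); [intros; ring|].
        apply Ccont_minus; [apply Ccont_const|].
        eapply Cder_cont; apply (Cder_Clog (fun s => sh n (s, y))); [apply Cder_sh|assumption].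
      * eapply Cder_cont; apply (Cder_pw z (fun s => sh n (s, y))); [apply Cder_sh|assumption].
    + intros N s Hs; now apply H.
Qed.

Lemma udiff_zF0 y z : 4 < Re z -> udiff (zF0 y) z (zD0 y z).
Proof.
  intros Hz; split; [|split].
  - intros r Hr; exact (proj1 (zF0_cont y z r Hz Hr)).
  - intros r Hr; exact (proj2 (zF0_cont y z r Hz Hr)).
  - intros a b Ha Hab; destruct (zF0_rate y z a Ha Hz) as (K & K0 & H).
    exists (16 * K), (Rmin 1 (Re z - 4)); split; [lra|]; split; [apply Rmin_pos; lra|].
    intros r Hr; destruct (H r (proj1 Hr)) as (B & L & L' & R1 & R2).
    assert (Hb0 : forall u v, u 0%nat = RtoC 0 -> (forall n, Cmod (u n - v) <= K / (INR n + 1)) -> Cmod v <= 16 * K).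
    { intros u v E Q; specialize (Q 0%nat); rewrite E, Cmod_minus_sym in Q; simpl in Q.
      replace (v - 0)%C with v in Q by ring; lra. }
    split; [now apply (Hb0 (zS z (r, y)))|]; split; [now apply (Hb0 (zSd z (r, y)))|].
    intros h Hh.
    assert (Hh1 := Rlt_le_trans _ _ _ Hh (Rmin_l _ _)).
    assert (Hh2 := Rlt_le_trans _ _ _ Hh (Rmin_r _ _)).
    assert (Hzh : 4 < Re (z + h)).
    { change (Re (z + h)) with (Re z + Re h).
      generalize (re_le_Cmod h) (Rle_abs (- Re h)); rewrite Rabs_Ropp; lra. }
    destruct (zF0_rate y (z + h) a Ha Hzh) as (K' & _ & Q).
    destruct (Q r (proj1 Hr)) as (_ & Lh & _).
    eapply Climit_bound; [exact (Climit_minus _ _ _ _ (Climit_minus _ _ _ _ Lh L) (Climit_scal h _ _ L'))|].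
    intros N; simpl; unfold zS, zSd.
    assert (Ph := Cmod_ge_0 h).
    replace (Csum _ N - Csum _ N - h * Csum _ N)%C with
      (Csum (fun n => (sg n * (pw (z + h) (sh n (r, y)) - pw z (sh n (r, y)) -
         h * (- Clog (sh n (r, y)) * pw z (sh n (r, y)))))%C) N).
    + apply Csum_bound; [assert (0 <= Cmod h * Cmod h) by nra; nra|].
      intros n; rewrite Cmod_mult, Cmod_sg, Rmult_1_l.
      eapply Rle_trans; [apply pw_taylor; lra|].
      unfold Rdiv; rewrite (Rmult_comm (16 * K)), (Rmult_assoc (Cmod h * Cmod h)),
        (Rmult_assoc 16 K), <- (Rmult_assoc (Cmod h * Cmod h)), (Rmult_comm (Cmod h * Cmod h) 16).
      apply Rmult_le_compat_l; [assert (0 <= Cmod h * Cmod h) by nra; lra|apply B].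
    + induction N as [|N IH]; simpl; [|rewrite IH]; ring.
Qed.

(* Euler's averaging step, started from the series [zF0]; valid for [4 - m < Re z]. *)
Fixpoint zF (y : R) (m : nat) (z : C) (r : R) : C :=
  match m with
  | O => zF0 y z r
  | S k => (/ 2 * pw z (r, y) + / 2 * (z * Iu (zF y k (z + 1)%C) r))%C
  end.

Lemma udiff_zF_S y m z D : udiff (zF y m) (z + 1) D ->
  (exists e, 0 < e /\ forall h, Cmod h < e -> forall r, 0 < r -> Ccont (zF y m (z + 1 + h)%C) r) ->
  udiff (zF y (S m)) z (fun r => (/ 2 * (- Clog (r, y) * pw z (r, y)) +
    / 2 * (Iu (zF y m (z + 1)%C) r + z * Iu D r))%C).
Proof.
  intros H He; simpl.
  apply (udiff_plus (fun z r => (/ 2 * pw z (r, y))%C) (fun z r => (/ 2 * (z * Iu (zF y m (z + 1)%C) r))%C)).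
  - apply (udiff_scal (/ 2)%C (fun z r => pw z (r, y))), udiff_pw.
  - apply (udiff_scal (/ 2)%C (fun z r => (z * Iu (zF y m (z + 1)%C) r)%C)).
    apply (udiff_mulz (fun z r => Iu (zF y m (z + 1)%C) r)); now apply udiff_Iu.
Qed.

Lemma Re_plus_gt z h c : c < Re z -> Cmod h < Re z - c -> c < Re (z + h).
Proof.
  intros Hz Hh; change (Re (z + h)) with (Re z + Re h).
  generalize (re_le_Cmod h) (Rle_abs (- Re h)); rewrite Rabs_Ropp; lra.
Qed.

Lemma Re_plus_1 z : Re (z + 1) = Re z + 1.
Proof. reflexivity. Qed.

Lemma udiff_zF y m z : 4 - INR m < Re z -> exists D, udiff (zF y m) z D.
Proof.
  revert z; induction m as [|m IH]; intros z Hz.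
  - exists (zD0 y z); apply udiff_zF0; simpl in Hz; lra.
  - rewrite S_INR in Hz.
    destruct (IH (z + 1)%C) as [D HD]; [rewrite Re_plus_1; lra|].
    eexists; apply (udiff_zF_S y m z D HD).
    exists (Re (z + 1) - (4 - INR m)); rewrite Re_plus_1; split; [lra|].
    intros h Hh r Hr; destruct (IH (z + 1 + h)%C) as [D' HD'].
    + apply Re_plus_gt; rewrite Re_plus_1; lra.
    + exact (proj1 HD' r Hr).
Qed.

Lemma zF_cont y m z r : 4 - INR m < Re z -> 0 < r -> Ccont (zF y m z) r.
Proof. intros Hz Hr; destruct (udiff_zF y m z Hz) as [D HD]; exact (proj1 HD r Hr). Qed.

Lemma pw_small z a eps : 0 < a -> 0 < Re z -> 0 < eps ->
  exists N, forall n w, (N <= n)%nat -> INR n + a <= Re w -> Cmod (pw z w) <= eps.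
Proof.
  intros Ha Hz He; set (c := exp (2 * Rabs (Im z))); assert (c0 : 0 < c) by apply exp_pos.
  set (T := exp (ln (c / eps) / Re z)).
  destruct (INR_unbounded T) as [N HN].
  exists N; intros n w Hn Hw; apply le_INR in Hn; assert (PN := pos_INR n).
  assert (Pw : 0 < Re w) by lra.
  eapply Rle_trans; [now apply Cmod_pw_le|]; fold c.
  assert (Q : 0 < c / eps) by (now apply Rdiv_lt_0_compat).
  apply Rle_trans with (c * / (c / eps)); [|right; field; lra].
  apply Rmult_le_compat_l; [lra|].
  rewrite <- (exp_ln (c / eps)) by exact Q; rewrite <- exp_Ropp; apply exp_le.
  assert (L : ln T <= ln (Cmod w)).
  { apply ln_le; [apply exp_pos|].
    generalize (re_le_Cmod w) (Rle_abs (Re w)); lra. }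
  unfold T in L; rewrite ln_exp in L.
  apply (Rmult_le_compat_l (Re z)) in L; [|lra].
  replace (Re z * (ln (c / eps) / Re z)) with (ln (c / eps)) in L by (field; lra).
  lra.
Qed.

Lemma zS_step z r y N : 0 < r -> zS z (r, y) N =
  (/ 2 * (pw z (r, y) - sg N * pw z (sh N (r, y))) + / 2 * (z * Iu (fun s => zS (z + 1) (s, y) N) r))%C.
Proof.
  intros Hr.
  assert (E : Iu (fun s => (- z * zS (z + 1) (s, y) N)%C) r = (zS z ((r + 1)%R, y) N - zS z (r, y) N)%C).
  { apply (Cint_FTC (fun s => zS z (s, y) N)); [lra| |].
    - intros s Hs; apply Cder_zS; lra.
    - intros s Hs; apply Ccont_mult; [apply Ccont_const|].
      eapply Cder_cont, Cder_zS; lra. }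
  unfold Iu in E; rewrite Cint_scal in E; [|lra|].
  2:{ intros s Hs; eapply Cder_cont, Cder_zS; lra. }
  rewrite zS_shift in E; unfold Iu.
  set (J := Cint _ _ _) in *.
  transitivity (/ 2 * (pw z (r, y) - sg N * pw z (sh N (r, y))) +
    / 2 * (- (- z * J)))%C; [rewrite E; field|field].
Qed.

Lemma zF_conv y m z : 4 - INR m < Re z -> 0 < Re z -> zS_conv y z (zF y m z).
Proof.
  revert z; induction m as [|m IH]; intros z Hz Hz0.
  - apply zF0_conv; simpl in Hz; lra.
  - rewrite S_INR in Hz; intros a b eps Ha Hab He.
    assert (Pz := Cmod_ge_0 z).
    assert (He' : 0 < eps / (2 * (Cmod z + 1))) by (apply Rdiv_lt_0_compat; lra).
    destruct (IH (z + 1)%C ltac:(rewrite Re_plus_1; lra) ltac:(rewrite Re_plus_1; lra)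
       a (b + 1) _ Ha ltac:(lra) He') as [N HN].
    destruct (pw_small z a eps Ha Hz0 He) as [N' HN'].
    exists (Nat.max N N'); intros n r Hn Hr.
    assert (Hr0 : 0 < r) by lra.
    rewrite zS_step by exact Hr0; simpl zF.
    assert (Cz : forall s, 0 < s -> Ccont (fun s => zS (z + 1) (s, y) n) s).
    { intros s Hs; eapply Cder_cont, Cder_zS, Hs. }
    assert (Cf : forall s, 0 < s -> Ccont (zF y m (z + 1)%C) s).
    { intros s Hs; apply zF_cont; [rewrite Re_plus_1; lra|exact Hs]. }
    assert (E : (Iu (fun s => zS (z + 1) (s, y) n) r - Iu (zF y m (z + 1)%C) r)%C =
      Iu (fun s => (zS (z + 1) (s, y) n - zF y m (z + 1)%C s)%C) r).
    { unfold Iu; rewrite Cint_minus; auto using Ccont_pos_on; lra. }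
    replace (_ - _)%C with (/ 2 * (- (sg n * pw z (sh n (r, y))) +
      z * (Iu (fun s => zS (z + 1) (s, y) n) r - Iu (zF y m (z + 1)%C) r)))%C by ring.
    rewrite E, Cmod_mult, Cmod_inv, Cmod_R, Rabs_pos_eq by (try lra; intros E2; injection E2; lra).
    apply Rle_trans with (/ 2 * (eps + Cmod z * (2 * (eps / (2 * (Cmod z + 1)))))).
    + apply Rmult_le_compat_l; [lra|].
      eapply Rle_trans; [apply Cmod_triangle|]; rewrite Cmod_opp, !Cmod_mult, Cmod_sg, Rmult_1_l.
      apply Rplus_le_compat.
      * apply (HN' n); [lia|rewrite Re_sh; simpl; lra].
      * apply Rmult_le_compat_l; [exact Pz|]; apply Iu_bound; [exact Hr0| |].
        -- intros s Hs; apply Ccont_minus; auto.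
        -- intros s Hs; apply HN; [lia|lra].
    + replace (2 * (eps / (2 * (Cmod z + 1)))) with (eps * / (Cmod z + 1)) by (field; lra).
      assert (Cmod z * / (Cmod z + 1) <= 1).
      { apply Rmult_le_reg_r with (Cmod z + 1); [lra|].
        rewrite Rmult_assoc, Rinv_l; lra. }
      nra.
Qed.

Lemma zF_consistent y m z r : 4 - INR m < Re z -> 0 < r -> zF y (S m) z r = zF y m z r.
Proof.
  revert z r; induction m as [|m IH]; intros z r Hz Hr.
  - simpl in Hz; apply (Climit_unique (zS z (r, y))).
    + apply zS_conv_Climit; [exact Hr|apply zF_conv; simpl; lra].
    + apply zS_conv_Climit; [exact Hr|apply zF_conv; simpl; lra].
  - rewrite S_INR in Hz.
    change (zF y (S (S m)) z r) with (/ 2 * pw z (r, y) + / 2 * (z * Iu (zF y (S m) (z + 1)%C) r))%C.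
    change (zF y (S m) z r) with (/ 2 * pw z (r, y) + / 2 * (z * Iu (zF y m (z + 1)%C) r))%C.
    do 3 f_equal; unfold Iu, Cint; f_equal; apply RInt_ext; intros s Hs;
      rewrite Rmin_left in Hs by lra; rewrite IH; auto; try (rewrite Re_plus_1); lra.
Qed.

Lemma zF_consistent_le y m n z r : 4 - INR m < Re z -> 0 < r -> (m <= n)%nat ->
  zF y n z r = zF y m z r.
Proof.
  intros Hz Hr H; induction H as [|n H IH]; [reflexivity|].
  rewrite zF_consistent; auto; apply le_INR in H; lra.
Qed.

Lemma is_derive_C_eps (f : C -> C) (z D : C) :
  @is_derive C_AbsRing C_NormedModule f z D <->
  forall eps, 0 < eps -> exists d, 0 < d /\
    forall h, Cmod h < d -> Cmod (f (z + h)%C - f z - h * D) <= eps * Cmod h.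
Proof.
  split.
  - intros [_ H] eps He.
    specialize (H z (fun P HP => HP) (mkposreal _ He)).
    apply (locally_le_locally_norm (K := C_AbsRing) (V := AbsRing_NormedModule C_AbsRing)) in H.
    destruct H as [d Hd]; exists d; split; [apply cond_pos|].
    intros h Hh; specialize (Hd (z + h)%C).
    assert (E : (z + h - z)%C = h) by ring.
    change (Cmod (z + h - z)%C < d ->
      Cmod (f (z + h)%C - f z - (z + h - z) * D) <= eps * Cmod (z + h - z)) in Hd.
    rewrite E in Hd; now apply Hd.
  - intros H; split.
    + apply (is_linear_scal_l (K := C_AbsRing) (V := C_NormedModule)).
    + intros x Hx eps.
      apply (is_filter_lim_locally_unique (K := C_AbsRing) (V := AbsRing_NormedModule C_AbsRing)) in Hx; subst x.
      destruct (H eps (cond_pos eps)) as [d [d0 Hd]].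
      apply (locally_norm_le_locally (K := C_AbsRing) (V := AbsRing_NormedModule C_AbsRing)).
      exists (mkposreal _ d0); refine (fun (w : C) Hw => _).
      change (Cmod (w - z)%C < d) in Hw.
      change (Cmod (f w - f z - (w - z) * D) <= eps * Cmod (w - z)).
      specialize (Hd (w - z)%C Hw); replace (z + (w - z))%C with w in Hd by ring; exact Hd.
Qed.

Lemma is_derive_C_quadratic (f : C -> C) (z D : C) M d : 0 < d ->
  (forall h, Cmod h < d -> Cmod (f (z + h)%C - f z - h * D) <= M * (Cmod h * Cmod h)) ->
  @is_derive C_AbsRing C_NormedModule f z D.
Proof.
  intros Hd H; apply is_derive_C_eps; intros eps He.
  assert (P := Rabs_pos M).
  assert (Q : 0 < eps / (Rabs M + 1)) by (apply Rdiv_lt_0_compat; lra).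
  exists (Rmin d (eps / (Rabs M + 1))); split; [now apply Rmin_pos|].
  intros h Hh; eapply Rle_trans; [apply H, (Rlt_le_trans _ _ _ Hh (Rmin_l _ _))|].
  assert (Hh2 := Rlt_le_trans _ _ _ Hh (Rmin_r _ _)).
  rewrite <- Rmult_assoc; assert (Ph := Cmod_ge_0 h); apply Rmult_le_compat_r; [exact Ph|].
  apply Rle_trans with ((Rabs M + 1) * (eps / (Rabs M + 1))); [|right; field; lra].
  generalize (Rle_abs M); nra.
Qed.

(* Only the right half-disc matters: no identity theorem is needed. *)
Lemma C_derivative_right_unique (f g : C -> C) (D E : C) :
  @is_derive C_AbsRing C_NormedModule f (RtoC 0) D ->
  @is_derive C_AbsRing C_NormedModule g (RtoC 0) E ->
  (forall t, 0 < t -> f (RtoC t) = g (RtoC t)) -> D = E.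
Proof.
  intros Hf Hg HE.
  assert (B : forall eps, 0 < eps -> exists d, 0 < d /\ forall t, 0 < t < d ->
    Cmod (f 0 - g 0 + RtoC t * (D - E)) <= eps * t).
  { intros eps He; assert (He2 : 0 < eps / 2) by lra.
    apply is_derive_C_eps with (eps := eps / 2) in Hf; [|exact He2].
    apply is_derive_C_eps with (eps := eps / 2) in Hg; [|exact He2].
    destruct Hf as (d & d0 & Hd); destruct Hg as (e & e0 & He').
    exists (Rmin d e); split; [now apply Rmin_pos|].
    intros t Ht.
    assert (Hm : Cmod (RtoC t) = t) by (rewrite Cmod_R; apply Rabs_pos_eq; lra).
    assert (T1 : t < d) by (apply Rlt_le_trans with (1 := proj2 Ht), Rmin_l).
    assert (T2 : t < e) by (apply Rlt_le_trans with (1 := proj2 Ht), Rmin_r).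
    specialize (Hd (RtoC t)); specialize (He' (RtoC t)); rewrite Hm, Cplus_0_l in Hd, He'.
    rewrite HE in Hd by lra.
    replace (f 0 - g 0 + RtoC t * (D - E))%C with
      ((g (RtoC t) - g 0 - RtoC t * E) - (g (RtoC t) - f 0 - RtoC t * D))%C by ring.
    eapply Rle_trans; [apply Cmod_minus_le|]; specialize (Hd T1); specialize (He' T2); lra. }
  assert (Z : (f 0 - g 0)%C = RtoC 0).
  { apply Cmod_eq_0, Rle_antisym; [|apply Cmod_ge_0].
    apply Rnot_lt_le; intros P; set (q := Cmod (f 0 - g 0)) in *.
    destruct (B 1 Rlt_0_1) as (d & d0 & Hd).
    assert (Pm := Cmod_ge_0 (D - E)).
    set (u := q / (2 * (Cmod (D - E) + 1))).
    assert (u0 : 0 < u) by (apply Rdiv_lt_0_compat; lra).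
    assert (Hu : 2 * (u * (Cmod (D - E) + 1)) = q) by (unfold u; field; lra).
    set (t := Rmin (d / 2) u).
    assert (t0 : 0 < t) by (apply Rmin_pos; lra).
    assert (t1 : t <= d / 2) by apply Rmin_l.
    assert (t2 : t <= u) by apply Rmin_r.
    specialize (Hd t ltac:(lra)).
    assert (q <= Cmod (f 0 - g 0 + RtoC t * (D - E)) + Cmod (RtoC t * (D - E))).
    { unfold q; replace (f 0 - g 0)%C with ((f 0 - g 0 + RtoC t * (D - E)) - RtoC t * (D - E))%C at 1 by ring.
      apply Cmod_minus_le. }
    rewrite Cmod_mult, Cmod_R, Rabs_pos_eq in H by lra.
    nra. }
  assert (W : (D - E)%C = RtoC 0).
  { apply Cmod_eq_0, Rle_antisym; [|apply Cmod_ge_0].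
    apply Rnot_lt_le; intros P; set (q := Cmod (D - E)) in *.
    destruct (B (q / 2)) as (d & d0 & Hd); [lra|].
    specialize (Hd (d / 2) ltac:(lra)).
    rewrite Z, Cplus_0_l, Cmod_mult, Cmod_R, Rabs_pos_eq in Hd by lra.
    fold q in Hd; nra. }
  replace D with ((D - E) + E)%C by ring; rewrite W; ring.
Qed.

Lemma is_series_Climit (a : nat -> C) (l : C) :
  @is_series C_AbsRing C_NormedModule a l <-> Climit (Csum a) l.
Proof.
  assert (E : forall n, sum_n a n = Csum a (S n)).
  { intros n; induction n as [|n IH].
    - rewrite sum_O; simpl; ring.
    - rewrite sum_Sn, IH; reflexivity. }
  unfold is_series.
  rewrite (filterlim_locally_ball_norm (K := C_AbsRing) (U := C_NormedModule)).
  split.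
  - intros H eps He; destruct (H (mkposreal _ He)) as [N HN].
    exists (S N); intros n Hn; destruct n as [|n]; [lia|].
    specialize (HN n ltac:(lia)).
    rewrite <- E; exact HN.
  - intros H eps; destruct (H eps (cond_pos eps)) as [N HN].
    exists N; intros n Hn; specialize (HN (S n) ltac:(lia)); rewrite <- E in HN; exact HN.
Qed.

Lemma zetaE_partial_sums z x N : Csum (zetaE_term z x) N = zS z x N.
Proof.
  apply Csum_ext; intros n; unfold zetaE_term, pw, sg, sh, Cpower.
  rewrite Cexp_opp; reflexivity.
Qed.

Definition zm (z : C) : nat := Z.to_nat (up (5 - Re z)).

Lemma zm_spec z : 5 - INR (zm z) < Re z.
Proof.
  unfold zm; destruct (archimed (5 - Re z)) as [H _].
  assert (IZR (up (5 - Re z)) <= INR (Z.to_nat (up (5 - Re z)))); [|lra].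
  rewrite INR_IZR_INZ; apply IZR_le; lia.
Qed.

Definition zE (y r : R) (z : C) : C := zF y (zm z) z r.

Lemma zE_zF y r z m : 4 - INR m < Re z -> 0 < r -> zE y r z = zF y m z r.
Proof.
  intros H Hr; assert (K := zm_spec z); unfold zE.
  rewrite <- (zF_consistent_le y (zm z) (Nat.max m (zm z))) by (lia || lra).
  apply zF_consistent_le; (lia || lra).
Qed.

Lemma is_zetaE_zE y r : 0 < r -> is_zetaE (r, y) (zE y r).
Proof.
  intros Hr; split.
  - intros z; assert (K := zm_spec z); destruct (udiff_zF y (zm z) z ltac:(lra)) as [D (_ & _ & H)].
    destruct (H r r Hr (Rle_refl r)) as (M & d & _ & d0 & Q).
    destruct (Q r ltac:(lra)) as (_ & _ & B).
    exists (D r); apply is_derive_C_quadratic with M (Rmin d 1); [apply Rmin_pos; lra|].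
    intros h Hh.
    rewrite (zE_zF y r (z + h) (zm z)).
    + apply B, (Rlt_le_trans _ _ _ Hh (Rmin_l _ _)).
    + apply Re_plus_gt; [lra|].
      generalize (Rlt_le_trans _ _ _ Hh (Rmin_r _ _)); lra.
    + exact Hr.
  - intros z Hz; apply is_series_Climit.
    apply (Climit_ext (zS z (r, y))); [intros; now rewrite zetaE_partial_sums|].
    apply (zS_conv_Climit y z (fun s => zF y (zm z) z s)); [exact Hr|].
    apply zF_conv; [generalize (zm_spec z); lra|exact Hz].
Qed.

Lemma is_zetaE_zetaE x : 0 < Re x -> is_zetaE x (fun z => zetaE z x).
Proof.
  intros H; unfold zetaE; apply epsilon_spec; exists (zE (Im x) (Re x)).
  replace x with (Re x, Im x) at 1 by (now destruct x); now apply is_zetaE_zE.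
Qed.

(** * The derivative at [0] *)

Definition lS (x : C) (N : nat) : C := Csum (fun n => (sg n * Clog (sh n x))%C) N.

Lemma lS_shift (r y : R) N :
  lS (r + 1, y) N = (Clog (r, y) - sg N * Clog (sh N (r, y)) - lS (r, y) N)%C.
Proof.
  induction N as [|N IH].
  - unfold lS; simpl; replace (sh 0 (r, y)) with ((r, y) : C).
    + unfold sg; simpl; ring.
    + unfold sh; apply C_ext; simpl; ring.
  - unfold lS in *; simpl Csum; rewrite IH, sh_succ, sg_S; ring.
Qed.

Lemma Cder_lS r y N : 0 < r -> Cder (fun s => lS (s, y) N) r (zS 1 (r, y) N).
Proof.
  intros H; unfold lS, zS.
  apply (Cder_Csum (fun n s => (sg n * Clog (sh n (s, y)))%C)); intros n.
  assert (P : 0 < Re (sh n (r, y))) by now apply Re_sh_pos.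
  replace (pw 1 (sh n (r, y))) with (1 / sh n (r, y))%C.
  - apply Cder_scal, (Cder_Clog (fun s => sh n (s, y))); [apply Cder_sh|exact P].
  - replace (RtoC 1) with (0 + 1)%C at 2 by ring; now rewrite pw_succ, pw_0.
Qed.

Lemma Iu_zS_1 (r y : R) N : 0 < r -> Iu (fun s => zS 1 (s, y) N) r =
  (Clog (r, y) - sg N * Clog (sh N (r, y)) - 2 * lS (r, y) N)%C.
Proof.
  intros Hr; unfold Iu; rewrite (Cint_FTC (fun s => lS (s, y) N)).
  - rewrite lS_shift; ring.
  - lra.
  - intros s Hs; apply Cder_lS; lra.
  - intros s Hs; eapply Cder_cont, Cder_zS; lra.
Qed.

Lemma zetaE'_0 (r y : R) : 0 < r ->
  zetaE' 0 (r, y) = (/ 2 * (Iu (zF y 4 1) r - Clog (r, y)))%C.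
Proof.
  intros Hr.
  destruct (is_zetaE_zetaE (r, y) Hr) as [H1 H2].
  destruct (H1 0) as [D HD].
  unfold zetaE'; rewrite (is_C_derive_unique _ _ _ HD).
  assert (R4 : 4 - INR 4 < Re 1) by (simpl; lra).
  destruct (udiff_zF y 4 (0 + 1)%C) as [E HE]; [simpl; lra|].
  destruct (udiff_zF_S y 4 0 E HE) as (_ & _ & Q).
  { exists 1; split; [lra|]; intros h Hh s Hs; apply zF_cont; [|exact Hs].
    apply Re_plus_gt; simpl; lra. }
  destruct (Q r r Hr (Rle_refl r)) as (M & d & _ & d0 & B).
  destruct (B r ltac:(lra)) as (_ & _ & B3).
  apply (is_derive_C_quadratic (fun z => zF y 5 z r)) in B3; [|exact d0].
  rewrite (C_derivative_right_unique _ _ _ _ HD B3).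
  - rewrite pw_0, !Cplus_0_l; field.
  - intros t Ht; apply (Climit_unique (zS t (r, y))).
    + apply (Climit_ext (Csum (zetaE_term t (r, y)))); [intros; apply zetaE_partial_sums|].
      apply is_series_Climit, H2; exact Ht.
    + apply zS_conv_Climit; [exact Hr|]; apply zF_conv; simpl; lra.
Qed.

Lemma zS_1_conv y : zS_conv y 1 (zF y 4 1).
Proof. apply zF_conv; simpl; lra. Qed.

Lemma Climit_Iu (U : nat -> R -> C) V r : 0 < r ->
  (forall n s, 0 < s -> Ccont (U n) s) -> (forall s, 0 < s -> Ccont V s) ->
  (forall eps, 0 < eps -> exists N, forall n s, (N <= n)%nat -> r <= s <= r + 1 ->
     Cmod (U n s - V s) <= eps) -> Climit (fun n => Iu (U n) r) (Iu V r).
Proof.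
  intros Hr HU HV H eps He; destruct (H (eps / 4)) as [N HN]; [lra|].
  exists N; intros n Hn.
  replace (Iu (U n) r - Iu V r)%C with (Iu (fun s => (U n s - V s)%C) r).
  - apply Rle_lt_trans with (2 * (eps / 4)); [|lra].
    apply Iu_bound; auto; intros; apply Ccont_minus; auto.
  - unfold Iu; rewrite Cint_minus; auto using Ccont_pos_on; lra.
Qed.

Lemma zetaE'_0_lim (r y : R) : 0 < r ->
  Climit (fun N => (- lS (r, y) N - / 2 * (sg N * Clog (sh N (r, y))))%C) (zetaE' 0 (r, y)).
Proof.
  intros Hr; rewrite zetaE'_0 by exact Hr.
  apply (Climit_ext (fun N => / 2 * (Iu (fun s => zS 1 (s, y) N) r - Clog (r, y)))%C).
  { intros N; rewrite Iu_zS_1 by exact Hr; field. }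
  apply Climit_scal, Climit_minus; [|apply Climit_const].
  apply Climit_Iu; [exact Hr| | |].
  - intros n s Hs; eapply Cder_cont, Cder_zS, Hs.
  - intros s Hs; apply zF_cont; simpl; lra.
  - intros eps He; apply zS_1_conv; lra.
Qed.

(** * The logarithm of [tGamma] *)

Lemma zetaE'_0_lim_C x : 0 < Re x ->
  Climit (fun N => (- lS x N - / 2 * (sg N * Clog (sh N x)))%C) (zetaE' 0 x).
Proof. destruct x as [r y]; apply zetaE'_0_lim. Qed.

Definition lG (x : C) : C := (zetaE' 0 x + zetaE1' 0)%C.

Definition lP (x : C) (N : nat) : C := (- lS x (S N) - lS 1 N)%C.

Lemma Clog_diff_bound w x : 0 < Re w -> 0 <= Re x ->
  Cmod (Clog (w + x) - Clog w) <= 2 * (Cmod x / Re w).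
Proof.
  intros Hw Hx.
  replace (Clog (w + x) - Clog w)%C with (Clog (w + RtoC 1 * x) - Clog (w + RtoC 0 * x))%C.
  2:{ replace (w + RtoC 0 * x)%C with w by ring; now replace (w + RtoC 1 * x)%C with (w + x)%C by ring. }
  assert (Q : forall t, 0 <= t <= 1 -> Re w <= Re (w + RtoC t * x)).
  { intros t Ht; replace (Re (w + RtoC t * x)) with (Re w + t * Re x) by (unfold Re; simpl; ring). nra. }
  apply (Cder_bound (fun t => Clog (w + RtoC t * x)) (fun t => (x / (w + RtoC t * x))%C)).
  - intros t Ht; specialize (Q t Ht); apply Cder_Clog; [apply Cder_affine|lra].
  - intros t Ht; specialize (Q t Ht).
    rewrite Cmod_div by (apply C_neq0_Re; lra).
    apply Rmult_le_compat_l; [apply Cmod_ge_0|]; apply Rinv_le_contravar; [exact Hw|].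
    eapply Rle_trans; [exact Q|]; eapply Rle_trans; [apply Rle_abs|apply re_le_Cmod].
Qed.

Lemma sh_1 N : sh N 1 = RtoC (INR (S N)).
Proof. unfold sh; now rewrite S_INR, RtoC_plus. Qed.

Lemma sh_S_1 N x : sh (S N) x = (sh N 1 + x)%C.
Proof. unfold sh; rewrite S_INR, RtoC_plus; ring. Qed.

Lemma Re_sh_1 N : Re (sh N 1) = INR N + 1.
Proof. reflexivity. Qed.

Lemma lP_lim x : 0 < Re x -> Climit (lP x) (lG x).
Proof.
  intros Hx.
  assert (H1 := Climit_succ _ _ (zetaE'_0_lim_C x Hx)).
  assert (H2 := zetaE'_0_lim_C 1 Rlt_0_1 : Climit _ (zetaE1' 0)).
  assert (H3 : Climit (fun N => (/ 2 * (sg N * (Clog (sh N 1 + x) - Clog (sh N 1))))%C) 0).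
  { intros eps He.
    destruct (inv_INR_small (Cmod x) eps (Cmod_ge_0 x) He) as [N HN].
    exists N; intros n Hn; specialize (HN n Hn).
    replace (/ 2 * (sg n * (Clog (sh n 1 + x) - Clog (sh n 1))) - 0)%C with
      (/ 2 * (sg n * (Clog (sh n 1 + x) - Clog (sh n 1))))%C by ring.
    rewrite !Cmod_mult, Cmod_sg, Cmod_inv, Cmod_R, Rabs_pos_eq, Rmult_1_l
      by (try lra; intros E2; injection E2; lra).
    assert (Pn := pos_INR n).
    assert (B : Cmod (Clog (sh n 1 + x) - Clog (sh n 1)) <= 2 * (Cmod x / Re (sh n 1))).
    { apply Clog_diff_bound; [rewrite Re_sh_1|]; lra. }
    rewrite Re_sh_1 in B; lra. }
  replace (lG x) with (zetaE' 0 x + zetaE1' 0 - 0)%C by (unfold lG; ring).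
  refine (Climit_ext _ _ _ _ (Climit_minus _ _ _ _ (Climit_plus _ _ _ _ H1 H2) H3)).
  intros N; simpl; unfold lP; rewrite sg_S, sh_S_1; field.
Qed.

Lemma lS_S x N : lS x (S N) = (lS x N + sg N * Clog (sh N x))%C.
Proof. reflexivity. Qed.

Lemma zS_S z x N : zS z x (S N) = (zS z x N + sg N * pw z (sh N x))%C.
Proof. reflexivity. Qed.

Fixpoint harmonic (n : nat) : R :=
  match n with O => 0 | S k => harmonic k + / (INR k + 1) end.

Lemma harmonic_S n : harmonic (S n) = harmonic n + / (INR n + 1).
Proof. reflexivity. Qed.

Lemma sg_parity n : sg n = if Nat.even n then RtoC 1 else (- RtoC 1)%C.
Proof.
  induction n as [|n IH]; [reflexivity|].
  rewrite sg_S, IH, Nat.even_succ, <- Nat.negb_even; destruct (Nat.even n); simpl; ring.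
Qed.

Lemma pw_1 w : 0 < Re w -> pw 1 w = (/ w)%C.
Proof.
  intros H; replace (RtoC 1) with (0 + 1)%C by ring; rewrite pw_succ, pw_0 by exact H.
  field; now apply C_neq0_Re.
Qed.

Lemma Cprod1_tGamma x N : 0 < Re x ->
  Cprod1 (tGamma_factor x) N = Cexp (lP x N + Clog x - x * zS 1 1 N).
Proof.
  intros Hx; assert (E0 : sh 0 x = x) by (unfold sh; simpl; ring).
  induction N as [|N IH].
  - simpl; unfold lP, lS, zS; simpl; rewrite E0; unfold sg; simpl.
    replace (_ - _)%C with (RtoC 0) by ring; symmetry; apply Cexp_0.
  - simpl Cprod1; rewrite IH.
    assert (P1 : 0 < Re (sh N 1)) by (rewrite Re_sh_1; generalize (pos_INR N); lra).
    assert (N1 := C_neq0_Re _ P1).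
    set (e := (- (x / sh N 1) + (Clog (sh (S N) x) - Clog (sh N 1)))%C).
    assert (F : tGamma_factor x (S N) = Cexp (sg N * e)).
    { unfold tGamma_factor; rewrite <- sh_1.
      replace (1 + x / sh N 1)%C with (sh (S N) x / sh N 1)%C by (rewrite sh_S_1; field; exact N1).
      assert (W : (Cexp (- (x / sh N 1)) * (sh (S N) x / sh N 1))%C = Cexp e).
      { unfold e; rewrite Cexp_plus; f_equal; unfold Cminus; rewrite Cexp_plus, Cexp_opp.
        rewrite !Cexp_Clog; [reflexivity|exact P1|].
        rewrite sh_S_1; change (0 < Re (sh N 1) + Re x); lra. }
      rewrite W, sg_parity, Nat.odd_succ; destruct (Nat.even N).
      - f_equal; ring.
      - rewrite <- Cexp_opp; f_equal; ring. }
    rewrite F, <- Cexp_plus; f_equal; unfold e, lP.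
    rewrite (lS_S x (S N)), (lS_S 1 N), sg_S.
    change (zS 1 1 (S N)) with (zS 1 1 N + sg N * pw 1 (sh N 1))%C.
    rewrite pw_1 by exact P1; field; exact N1.
Qed.

Lemma zS_1_1_even n : zS 1 1 (2 * n) = RtoC (harmonic (2 * n) - harmonic n).
Proof.
  assert (P : forall k, 0 < Re (sh k 1)) by (intros k; rewrite Re_sh_1; generalize (pos_INR k); lra).
  induction n as [|n IH].
  - simpl; rewrite Rminus_0_r; reflexivity.
  - replace (2 * S n)%nat with (S (S (2 * n))) by lia.
    rewrite !zS_S, IH, !sg_S, !pw_1 by apply P.
    rewrite sg_parity, Nat.even_mul; cbv beta iota delta [Nat.even orb].
    rewrite !sh_1, !harmonic_S.
    assert (E : INR (2 * n) = 2 * INR n) by (rewrite mult_INR; reflexivity).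
    assert (Pn := pos_INR n).
    rewrite <- !RtoC_inv by (apply not_0_INR; lia).
    rewrite <- !RtoC_opp, <- !RtoC_mult, <- !RtoC_plus.
    f_equal; rewrite !S_INR, E; field; lra.
Qed.

Lemma ln_succ_bounds n :
  / (INR n + 2) <= ln (INR n + 2) - ln (INR n + 1) <= / (INR n + 1).
Proof.
  assert (Pn := pos_INR n).
  assert (B : forall u, 0 < u -> ln u <= u - 1).
  { intros u Hu; generalize (exp_ineq1_le (ln u)); rewrite exp_ln by exact Hu; lra. }
  split.
  - generalize (B ((INR n + 1) / (INR n + 2)) ltac:(apply Rdiv_lt_0_compat; lra)).
    rewrite ln_div by lra; replace ((INR n + 1) / (INR n + 2) - 1) with (- / (INR n + 2)) by (field; lra); lra.
  - generalize (B ((INR n + 2) / (INR n + 1)) ltac:(apply Rdiv_lt_0_compat; lra)).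
    rewrite ln_div by lra; replace ((INR n + 2) / (INR n + 1) - 1) with (/ (INR n + 1)) by (field; lra); lra.
Qed.

(* The [ln 2] comes out of [H_{2n} - H_n], as [H_n - ln (n+1)] converges. *)
Lemma zS_1_1_lim : Climit (zS 1 1) (RtoC (ln 2)).
Proof.
  set (u := fun n => RtoC (harmonic n - ln (INR n + 1))).
  destruct (Climit_telescope u 1) as [_ B].
  { intros n; unfold u; rewrite <- RtoC_minus, Cmod_R; simpl harmonic; rewrite S_INR.
    assert (Pn := pos_INR n).
    replace (1 / ((INR n + 1) * (INR n + 2))) with (/ (INR n + 1) - / (INR n + 2)) by (field; lra).
    replace (INR n + 1 + 1) with (INR n + 2) by ring.
    generalize (ln_succ_bounds n); intros; apply Rabs_le; lra. }
  assert (L : Climit (zS 1 1) (zF 0 4 1 1)).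
  { apply (zS_conv_Climit 0 1); [lra|apply zS_1_conv]. }
  replace (RtoC (ln 2)) with (zF 0 4 1 1); [exact L|].
  apply (Climit_unique (fun n => zS 1 1 (2 * n))).
  - intros eps He; destruct (L eps He) as [N HN]; exists N; intros; apply HN; lia.
  - intros eps He; destruct (inv_INR_small 3 eps) as [N HN]; [lra|exact He|].
    exists N; intros n Hn; specialize (HN n Hn).
    assert (Pn := pos_INR n).
    assert (E : INR (2 * n) = 2 * INR n) by (rewrite mult_INR; reflexivity).
    set (v := RtoC (ln (INR (2 * n) + 1) - ln (INR n + 1) - ln 2)).
    replace (zS 1 1 (2 * n) - RtoC (ln 2))%C with
      ((u (2 * n)%nat - Clim_seq u) - (u n - Clim_seq u) + v)%C.
    2:{ rewrite zS_1_1_even; unfold u, v; rewrite !RtoC_minus; ring. }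
    assert (V : Cmod v <= / (INR n + 1)).
    { unfold v; rewrite Cmod_R.
      replace (_ - _ - _) with (ln (INR (2 * n) + 1) - ln (INR (2 * n) + 2)).
      2:{ replace (INR (2 * n) + 2) with ((INR n + 1) * 2) by (rewrite E; ring).
          rewrite ln_mult by lra; ring. }
      generalize (ln_succ_bounds (2 * n)); rewrite E.
      assert (/ (2 * INR n + 1) <= / (INR n + 1)) by (apply Rinv_le_contravar; lra).
      assert (0 < / (2 * INR n + 2)) by (apply Rinv_0_lt_compat; lra).
      intros; apply Rabs_le; lra. }
    assert (B1 := B (2 * n)%nat); assert (B2 := B n); rewrite E in B1.
    assert (1 / (2 * INR n + 1) <= / (INR n + 1)).
    { unfold Rdiv; rewrite Rmult_1_l; apply Rinv_le_contravar; lra. }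
    eapply Rle_lt_trans; [apply Cmod_triangle|].
    generalize (Cmod_minus_le (u (2 * n)%nat - Clim_seq u) (u n - Clim_seq u)); lra.
Qed.

Lemma tGamma_eq x : 0 < Re x -> Cexp (lG x) = tGamma x.
Proof.
  intros Hx; unfold tGamma.
  rewrite (Climit_Clim_seq _ (Cexp (lG x + Clog x - x * RtoC (ln 2)))).
  - rewrite <- (Cexp_Clog x Hx) at 2; rewrite <- Cexp_opp, <- !Cexp_plus; f_equal; ring.
  - apply (Climit_ext (fun N => Cexp (lP x N + Clog x - x * zS 1 1 N))).
    { intros N; now rewrite Cprod1_tGamma. }
    apply Climit_Cexp, Climit_minus; [|apply Climit_scal, zS_1_1_lim].
    apply Climit_plus; [now apply lP_lim|apply Climit_const].
Qed.

Lemma lG_holomorphic x : 0 < Re x -> holomorphic_at lG x.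
Proof.
  intros Hx; destruct x as [r y]; simpl in Hx; set (x := (r, y) : C).
  set (K := 2 * (1 + / r) * (1 + / r)).
  assert (Hr := Rinv_0_lt_compat _ Hx).
  assert (K0 : 0 <= K) by (unfold K; nra).
  assert (F1 : Climit (zS 1 x) (zF y 4 1 r)).
  { apply (zS_conv_Climit y 1); [exact Hx|apply zS_1_conv]. }
  exists (RtoC (-1) * zF y 4 1 r)%C.
  apply is_derive_C_quadratic with (4 * K) (r / 2); [lra|].
  intros h Hh.
  assert (Hxh : 0 < Re (x + h)) by (apply Re_plus_gt; unfold x; simpl; lra).
  assert (Lh := lP_lim _ Hxh); assert (L0 := lP_lim x Hx).
  eapply Climit_bound.
  { exact (Climit_minus _ _ _ _ (Climit_minus _ _ _ _ Lh L0)
      (Climit_scal h _ _ (Climit_scal (RtoC (-1)) _ _ (Climit_succ _ _ F1)))). }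
  intros N; simpl; unfold lP.
  replace (_ - _)%C with
    (- Csum (fun n => (sg n * (Clog (sh n x + h) - Clog (sh n x) - h / sh n x))%C) (S N))%C.
  - rewrite Cmod_opp; assert (Ph := Cmod_ge_0 h).
    apply Csum_bound; [assert (0 <= Cmod h * Cmod h) by nra; nra|].
    intros n; rewrite Cmod_mult, Cmod_sg, Rmult_1_l.
    assert (Pn := pos_INR n).
    assert (Rs : Re (sh n x) = INR n + r) by reflexivity.
    assert (Ms : INR n + r <= Cmod (sh n x)).
    { rewrite <- Rs; eapply Rle_trans; [apply Rle_abs|apply re_le_Cmod]. }
    eapply Rle_trans; [apply Clog_bound; rewrite Rs; lra|].
    assert (D := inv_sq_decay r _ n Hx Ms); fold K in D.
    replace (4 * K * (Cmod h * Cmod h) / ((INR n + 1) * (INR n + 2))) with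
      (4 * (Cmod h * Cmod h) * (K / ((INR n + 1) * (INR n + 2)))) by (field; lra).
    unfold Rdiv at 1; rewrite <- Rmult_assoc; apply Rmult_le_compat_l; [nra|exact D].
  - assert (S : forall M, Csum (fun n => (sg n * (Clog (sh n x + h) - Clog (sh n x) - h / sh n x))%C) M =
      (lS (x + h) M - lS x M - h * zS 1 x M)%C).
    { intros M; unfold lS, zS; induction M as [|M IH]; simpl; [ring|].
      assert (PM : 0 < Re (sh M x)) by now apply Re_sh_pos.
      rewrite IH, pw_1 by exact PM.
      replace (sh M (x + h)) with (sh M x + h)%C by (unfold sh; ring).
      field; now apply C_neq0_Re. }
    rewrite S; ring.
Qed.

Lemma lG_real r : 0 < r -> Im (lG r) = 0.
Proof.
  intros Hr.
  assert (T : forall s N, 0 < s -> Im (lS (RtoC s) N) = 0).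
  { intros s N Hs; induction N as [|N IH]; [reflexivity|].
    rewrite lS_S.
    assert (A : Im (Clog (sh N (RtoC s))) = 0).
    { assert (P := Re_sh_pos N (RtoC s) Hs).
      simpl; unfold Carg; destruct (Rlt_dec 0 (Re (sh N (RtoC s)))); [|tauto].
      replace (Im (sh N (RtoC s))) with 0 by (simpl; ring).
      unfold Rdiv; rewrite Rmult_0_l; apply atan_0. }
    unfold Im in *; simpl in *; rewrite IH; unfold Im in *; rewrite A; ring. }
  assert (L := Climit_Im _ _ (lP_lim (RtoC r) Hr)).
  assert (L0 : is_lim_seq (fun n => Im (lP (RtoC r) n)) 0).
  { apply is_lim_seq_ext with (fun _ => 0); [|apply is_lim_seq_const].
    intros N; symmetry; unfold lP.
    change (- Im (lS (RtoC r) (S N)) + - Im (lS (RtoC 1) N) = 0).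
    rewrite !T by lra; ring. }
  apply is_lim_seq_unique in L; apply is_lim_seq_unique in L0.
  rewrite L in L0; now injection L0.
Qed.

Lemma is_log_tGamma_lG : is_log_tGamma lG.
Proof.
  split; [exact lG_holomorphic|]; split; [exact tGamma_eq|exact lG_real].
Qed.

Lemma holomorphic_vertical_continuity (f : C -> C) r y : 
  (forall t, holomorphic_at f (r, t)) -> continuity (fun t => Im (f (r, t * y))).
Proof.
  intros H t; apply continuity_pt_locally; intros eps.
  destruct (H (t * y)) as [D HD].
  apply is_derive_C_eps with (eps := 1) in HD; [|lra].
  destruct HD as (d & d0 & Hd).
  assert (P := Cmod_ge_0 D); assert (Py := Rabs_pos y); assert (Pe := cond_pos eps).
  set (q := eps / (Cmod D + 1)).
  assert (q0 : 0 < q) by (apply Rdiv_lt_0_compat; lra).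
  set (e := Rmin d q); assert (e0 : 0 < e) by now apply Rmin_pos.
  assert (s0 : 0 < e / (Rabs y + 1)) by (apply Rdiv_lt_0_compat; lra).
  exists (mkposreal _ s0); intros s Hs.
  change (Rabs (s - t) < e / (Rabs y + 1)) in Hs.
  set (h := (0, (s - t) * y) : C).
  assert (Eh : Cmod h < e).
  { eapply Rle_lt_trans; [apply Cmod_le_abs|]; unfold h; simpl.
    rewrite Rabs_R0, Rplus_0_l, Rabs_mult.
    apply Rle_lt_trans with (Rabs (s - t) * (Rabs y + 1)).
    - generalize (Rabs_pos (s - t)); nra.
    - replace e with (e / (Rabs y + 1) * (Rabs y + 1)) by (field; lra).
      apply Rmult_lt_compat_r; lra. }
  assert (Z : ((r, (t * y)%R) + h)%C = (r, s * y)) by (unfold h; apply C_ext; simpl; ring).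
  assert (h1 := Rlt_le_trans _ _ _ Eh (Rmin_l _ _)).
  assert (h2 := Rlt_le_trans _ _ _ Eh (Rmin_r _ _)).
  specialize (Hd h h1); rewrite Z in Hd.
  eapply Rle_lt_trans; [apply (im_le_Cmod (f (r, s * y)%R - f (r, t * y)%R))|].
  replace (f (r, s * y)%R - f (r, t * y)%R)%C with ((f (r, s * y)%R - f (r, t * y)%R - h * D) + h * D)%C by ring.
  eapply Rle_lt_trans; [apply Cmod_triangle|]; rewrite Cmod_mult.
  assert (Ph := Cmod_ge_0 h).
  replace (pos eps) with (q * (Cmod D + 1)) by (unfold q; field; lra).
  nra.
Qed.

Lemma Cexp_eq a b : Cexp a = Cexp b -> Re a = Re b /\ cos (Im a - Im b) = 1.
Proof.
  intros H.
  assert (E : Cexp (a - b) = RtoC 1).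
  { unfold Cminus; rewrite Cexp_plus, Cexp_opp, H; field; apply Cexp_neq0. }
  assert (M := Cmod_Cexp (a - b)); rewrite E, Cmod_R, Rabs_R1 in M.
  rewrite <- exp_0 in M; apply exp_inv in M.
  change (0 = Re a + - Re b) in M; split; [lra|].
  apply (f_equal fst) in E; simpl in E.
  change (exp (Re a + - Re b) * cos (Im a - Im b) = 1) in E.
  rewrite <- M, exp_0, Rmult_1_l in E; exact E.
Qed.

Lemma cos_eq_1_path (g : R -> R) : continuity g -> g 0 = 0 -> (forall t, cos (g t) = 1) -> g 1 = 0.
Proof.
  intros Hc H0 H1.
  destruct (Req_dec (g 1) 0) as [E|E]; [exact E|exfalso].
  assert (P := Rabs_pos_lt _ E).
  set (v := g 1 / (1 + Rabs (g 1))).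
  assert (Ev : g 1 = v * (1 + Rabs (g 1))) by (unfold v; field; lra).
  destruct (IVT_gen g 0 1 v Hc) as [c [_ Hg]].
  { rewrite H0; destruct (Rle_or_lt 0 (g 1)) as [Q|Q].
    - rewrite Rabs_pos_eq in * by exact Q; rewrite Rmin_left, Rmax_right by exact Q; nra.
    - rewrite Rabs_left in * by exact Q; rewrite Rmin_right, Rmax_left by lra; nra. }
  assert (C := H1 c); rewrite Hg in C.
  assert (S : sin v = 0).
  { generalize (sin2_cos2 v); rewrite C; unfold Rsqr; nra. }
  assert (V : 0 < Rabs v < 1).
  { unfold v, Rdiv; rewrite Rabs_mult, Rabs_inv, (Rabs_pos_eq (1 + _)) by lra.
    split; [apply Rmult_lt_0_compat; [lra|apply Rinv_0_lt_compat; lra]|].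
    apply Rmult_lt_reg_r with (1 + Rabs (g 1)); [lra|].
    rewrite Rmult_assoc, Rinv_l; lra. }
  assert (A : sin (Rabs v) = 0).
  { unfold Rabs; destruct (Rcase_abs v); [rewrite sin_neg|]; lra. }
  generalize (sin_gt_0 (Rabs v) ltac:(lra)) PI2_1; lra.
Qed.

Lemma is_log_tGamma_unique L M x : is_log_tGamma L -> is_log_tGamma M -> 0 < Re x -> L x = M x.
Proof.
  intros (L1 & L2 & L3) (M1 & M2 & M3) Hx; destruct x as [r y]; simpl in Hx.
  assert (E : forall t, Cexp (L (r, t)) = Cexp (M (r, t))).
  { intros t; now rewrite L2, M2. }
  apply C_ext; [now apply Cexp_eq|].
  assert (G : (fun t => Im (L (r, t * y)) - Im (M (r, t * y))) 1 = 0).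
  { apply (cos_eq_1_path (fun t => Im (L (r, t * y)) - Im (M (r, t * y)))).
    - apply (continuity_minus (fun t => Im (L (r, t * y))) (fun t => Im (M (r, t * y))));
        apply holomorphic_vertical_continuity; intros; [apply L1|apply M1]; exact Hx.
    - rewrite Rmult_0_l; change ((r, 0) : C) with (RtoC r); rewrite L3, M3 by exact Hx; ring.
    - intros t; apply Cexp_eq, E. }
  simpl in G; rewrite Rmult_1_l in G; unfold Im in *; lra.
Qed.

Theorem theorem4p2 :
  forall x : C, 0 < Re x ->
    log_tGamma x = (zetaE' 0 x + zetaE1' 0)%C.
Proof.
  intros x Hx; apply (is_log_tGamma_unique log_tGamma lG); [|exact is_log_tGamma_lG|exact Hx].
  unfold log_tGamma; apply epsilon_spec; exists lG; exact is_log_tGamma_lG.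
Qed.
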